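(* Let $p$ be a monic real polynomial of degree $d\ge2$ with $p(0)=0$ and $\lambda=p'(0)>1$, let $\rho=\log_\lambda d$, and let $f$ be the entire solution of $f(\lambda z)=p(f(z))$ with $f(0)=0$, $f'(0)=1$. Let $$N_f(x)=\sum_{\substack{|\xi|<x\\ f(\xi)=0}}1$$ be the zero counting function of $f$ (zeros counted with multiplicity), and let $\mu$ be the harmonic measure on the Julia set $\mathcal{J}(p)$. Then the following are equivalent: (1) the limit $\lim_{x\to\infty}x^{-\rho}N_f(x)$ does not exist; (2) the limit $\lim_{t\to0}t^{-\rho}\mu(B(0,t))$ does not exist.
   Context: $B(0,t)=\{w\in\mathbb{C}\mid|w|<t\}$. The harmonic measure $\mu$ on $\mathcal{J}(p)$ (harmonic measure with respect to $\infty$, i.e. the equilibrium measure) is the weak limit of the probability measures $\mu_n=d^{-n}\sum_{p^{(n)}(x)=\xi}\delta_x$ (preimages counted with multiplicity), where $p^{(n)}$ is the $n$-th iterate of $p$, $\xi$ is an arbitrary non-exceptional point and $\delta_x$ is the unit point mass at $x$. *)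

(* Defs.v *)
From HB Require Import structures.
From mathcomp Require Import all_boot all_order all_algebra.
From mathcomp Require Import all_classical all_reals all_analysis.
From mathcomp Require Import complex.

Set Implicit Arguments.
Unset Strict Implicit.
Unset Printing Implicit Defensive.

Import Order.TTheory GRing.Theory Num.Theory.
Import numFieldNormedType.Exports.

Local Open Scope classical_set_scope.
Local Open Scope complex_scope.
Local Open Scope ring_scope.

(* R[i] with the norm topology of the numeric field R[i]; as a normed module
   over itself, derivatives of R[i] -> R[i] are complex derivatives. *)
HB.instance Definition _ (R : rcfType) := NormedModule.copy R[i] R[i]^o.

Section Defs.
Context (R : realType).
Local Notation C := R[i].

Definition entire (f : C -> C) : Prop := forall z, derivable f z 1.

(* The m such that f(w) = (w - z)^m g(w) with g entire and g(z) <> 0; it is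
   unique unless f vanishes identically. *)
Definition zero_mult (f : C -> C) (z : C) : nat :=
  xget 0%N [set m | exists g : C -> C,
    [/\ entire g, g z != 0 & forall w, f w = (w - z) ^+ m * g w]].

(* A finitely supported sum: a nonzero entire function has finitely many zeros
   in each disc. *)
Definition zero_count (f : C -> C) (x : R) : R :=
  \sum_(z \in [set z : C | `|z| < x%:C /\ f z = 0]) ((zero_mult f z)%:R : R).

Definition iter_poly (p : {poly C}) (n : nat) : {poly C} :=
  iter n (fun q => p \Po q) 'X.

(* The metric of the Riemann sphere restricted to the plane. *)
Definition chordal (z w : C) : C :=
  2 * `|z - w| / (sqrtC (1 + `|z| ^+ 2) * sqrtC (1 + `|w| ^+ 2)).

(* The points having a neighbourhood on which the iterates of p are
   equicontinuous for the chordal metric, i.e. form a normal family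
   (Arzela-Ascoli); the point at infinity is always in the Fatou set of a
   polynomial of degree at least 2. *)
Definition fatou_set (p : {poly C}) : set C :=
  [set z | \forall y \near z, forall e : R, 0 < e ->
     \forall w \near y, forall n : nat,
       chordal (iter_poly p n).[y] (iter_poly p n).[w] < e%:C].

Definition julia_set (p : {poly C}) : set C := ~` fatou_set p.

(* Finite points only: infinity is always exceptional for a polynomial. *)
Definition exceptional (p : {poly C}) (xi : C) : Prop :=
  finite_set [set w : C | exists n : nat, (iter_poly p n).[w] = xi].

Definition borelC := g_sigma_algebraType (@open C).

(* Roots listed with multiplicity (for q != 0). *)
Definition roots_seq (q : {poly C}) : seq C :=
  sval (closed_field_poly_normal q).

(* d^(-n) times the sum of the unit masses at the solutions, with multiplicity,
   of p^(n)(x) = xi, where d is the degree of p. *)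
Definition preimage_measure (p : {poly C}) (xi : C) (n : nat) :
    {measure set borelC -> \bar R} :=
  let s := roots_seq (iter_poly p n - xi%:P) in
  mscale ((((size p).-1)%:R ^- n)%:nng : {nonneg R})
    (msum (fun k => \d_(nth 0 s k : borelC)) (size s)).

Definition weak_cvg (nu : nat -> {measure set borelC -> \bar R})
    (mu : {measure set borelC -> \bar R}) : Prop :=
  forall g : C -> R, continuous g -> (exists M : R, forall z, `|g z| <= M) ->
    (\int[nu n]_z (g z)%:E)%E @[n --> \oo] --> (\int[mu]_z (g z)%:E)%E.

(* Limit of the preimage measures for every choice of non-exceptional xi. *)
Definition harmonic_measure (p : {poly C}) (mu : probability borelC R) : Prop :=
  mu (~` julia_set p) = 0%E /\
  forall xi : C, ~ exceptional p xi -> weak_cvg (preimage_measure p xi) mu.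

End Defs.

(* Main.v *)
Require Import Defs.
From HB Require Import structures.
From mathcomp Require Import all_boot all_order all_algebra.
From mathcomp Require Import all_classical all_reals all_analysis.
From mathcomp Require Import measurable_realfun.
From mathcomp Require Import complex ring lra.

Set Implicit Arguments.
Unset Strict Implicit.
Unset Printing Implicit Defensive.

Import Order.TTheory GRing.Theory Num.Theory.
Import numFieldNormedType.Exports.
Import ComplexField.Normc.

Local Open Scope classical_set_scope.
Local Open Scope complex_scope.
Local Open Scope ring_scope.

(* Iterating the functional equation gives [p^(n) (f w) = f (lambda^n w)], so
   the zeros of [f] in the disc of radius [lambda^n r] correspond, with
   multiplicities, to the zeros of [p^(n)] in [f (B(0,r))]: there are
   [d^n mu_n (f (B(0,r)))] of them, where [mu_n] is the preimage measure of the
   non-exceptional point [0].  As [f z ~ z] at [0], the set [f (B(0,r))] lies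
   between two discs of radii close to [r], and testing the weak convergence
   of [mu_n] against cutoff functions squeezes [d^-n N_f (lambda^n r)], as [n]
   grows, between the values of [mu] on discs of radii close to [r].
   Since [d^-n = (lambda^n)^-rho], either of the two limits forces the other.

   The local behaviour of [f] at [0] follows from the mere existence of [f' 0],
   without Cauchy theory: [f z - f w] is [z - w] times the infinite product of
   the divided differences of [p] along the backward orbits of [f z] and [f w],
   divided by [lambda]. *)

(** * Complex numbers and complex derivatives *)

Section Complex.
Context (R : realType).
Local Notation C := R[i].
Local Notation N := (@normc R).
Implicit Types (z w : C).

(** [zero_mult] asks for an entire cofactor, so a bijection between zeros and roots is not enough to
    match multiplicities: the quotient [(f z - f w) / (z - w)] has to be entire in [z], the point
    [w] included. This shapes the local part: besides closeness of [f] to the identity, it yields a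
    Lipschitz bound for these quotients, which self-similarity turns into differentiability at [w].
    The other obstacle is that no comparison is exact. [f] distorts discs, and as nothing excludes
    circles of positive mass, weak convergence need not evaluate a disc. Each comparison enlarges
    the radius by a factor [kappa > 1], which costs [M = kappa ^ rho] once counts and masses are
    normalised; [M] can be as close to 1 as desired. The two implications differ in strength. For
    the limit at 0, [t] stays fixed while [n] grows. For the limit at infinity, one [n] must serve
    all radii of a fundamental annulus, while weak convergence treats one radius at a time; taking
    [kappa ^+ m = lam] leaves finitely many radii, and monotonicity fills the gaps. *)

Lemma normCE z : `|z| = (N z)%:C. Proof. by case: z. Qed.

Lemma normc_real (x : R) : N x%:C = `|x|.
Proof. by rewrite /= expr0n /= addr0 sqrtr_sqr. Qed.

Lemma normc_ge0 z : 0 <= N z.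
Proof. by case: z => a b; exact: sqrtr_ge0. Qed.

Lemma normc_eq0 z : (N z == 0) = (z == 0).
Proof.
apply/eqP/eqP => [/eq0_normc//|->].
exact: normc0.
Qed.

Lemma normc_gt0 z : (0 < N z) = (z != 0).
Proof. by rewrite lt_neqAle eq_sym normc_ge0 andbT normc_eq0. Qed.

Lemma ler_normcD z w : N (z + w) <= N z + N w.
Proof. exact: le_normcD. Qed.

Lemma normc_opp z : N (- z) = N z.
Proof. exact: normcN. Qed.

Lemma ler_normcB z w : N (z - w) <= N z + N w.
Proof. by rewrite (le_trans (ler_normcD _ _))// normc_opp. Qed.

Lemma normc_distC z w : N (z - w) = N (w - z).
Proof. by rewrite -normc_opp opprB. Qed.

Lemma normcX z n : N (z ^+ n) = N z ^+ n.
Proof.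
elim: n => [|n IHn]; first by rewrite !expr0 normc1.
by rewrite !exprS normcM IHn.
Qed.

Lemma normc_Re z : `|complex.Re z| <= N z.
Proof. by rewrite -lecR -normCE normc_ge_Re. Qed.

Lemma normc_Im z : `|complex.Im z| <= N z.
Proof.
case: z => a b /=; rewrite -sqrtr_sqr ler_wsqrtr// lerDr.
by rewrite sqr_ge0.
Qed.

Lemma normc_ReIm z : N z <= `|complex.Re z| + `|complex.Im z|.
Proof.
case: z => a b.
have -> : a +i* b = a%:C + 'i * b%:C.
  by apply/eqP; rewrite eq_complex /=; apply/andP; split; apply/eqP; ring.
apply: (le_trans (ler_normcD _ _)).
rewrite normcM !normc_real /=.
have -> : Num.sqrt (0 ^+ 2 + 1 ^+ 2) = 1 :> R by rewrite expr0n expr1n add0r sqrtr1.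
by rewrite mul1r; do 2!rewrite ?mul0r ?mulr0 ?mul1r ?subr0 ?subrr ?addr0 ?add0r.
Qed.

(** The topology of [R[i]] tests with radii in [R[i]], but a positive element of [R[i]] is real, so
    real radii suffice. *)
Lemma cvg_normcP (T : Type) (F : set_system T) {FF : Filter F} (u : T -> C) (l : C) :
  u @ F --> l <-> forall e : R, 0 < e -> \forall x \near F, N (u x - l) < e.
Proof.
split => [/cvgrPdist_lt ul e e0|ul].
  have := ul e%:C; rewrite ltcR => /(_ e0); apply: filterS => x.
  by rewrite normCE ltcR normc_distC.
apply/cvgrPdist_lt => e e0.
have ee : e = (complex.Re e)%:C by rewrite RRe_real // gtr0_real.
move: e0; rewrite ee ltcR => /ul; apply: filterS => x.
by rewrite normCE ltcR normc_distC.
Qed.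

(** Completeness comes from that of [R]: real and imaginary parts are 1-Lipschitz, hence inherit the
    Cauchy condition. *)
Lemma cvgC_cauchy (T : Type) (F : set_system T) {FF : ProperFilter F} (u : T -> C) :
  (forall e : R, 0 < e -> exists2 A : set T, F A & forall x y, A x -> A y -> N (u x - u y) < e) ->
  cvg (u @ F).
Proof.
move=> uC.
have key (g : C -> R) : (forall z w, `|g z - g w| <= N (z - w)) -> cvg ((g \o u) @ F).
  move=> gN; apply/cauchy_cvgP/cauchyP => e e0.
  have [A FA hA] := uC e e0; have [x Ax] := filter_ex FA.
  exists (g (u x)); change (F ((g \o u) @^-1` ball (g (u x)) e)).
  apply: filterS FA => y Ay /=; rewrite -ball_normE /=.
  exact: le_lt_trans (gN _ _) (hA _ _ Ax Ay).
have /cvg_ex[a ha] : cvg ((@complex.Re R \o u) @ F).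
  by apply: key => -[a b] [c d]; exact: (normc_Re ((a +i* b) - (c +i* d))).
have /cvg_ex[b hb] : cvg ((@complex.Im R \o u) @ F).
  by apply: key => -[a' b] [c d]; exact: (normc_Im ((a' +i* b) - (c +i* d))).
apply/cvg_ex; exists (a +i* b); apply/cvg_normcP => e e0.
have e20 : 0 < e / 2 by rewrite divr_gt0.
move/cvgrPdist_lt : ha => /(_ _ e20) ha; move/cvgrPdist_lt : hb => /(_ _ e20) hb.
apply: filterS2 ha hb => x /=; case: (u x) => c d /= ha hb.
rewrite (splitr e); apply: le_lt_trans (normc_ReIm ((c +i* d) - (a +i* b))) _.
apply: ltrD.
  by rewrite distrC.
by rewrite distrC.
Qed.

Lemma derivable_epsP (f : C -> C) z l :
  is_derive z 1 f l <-> forall e : R, 0 < e -> exists2 r : R, 0 < r &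
    forall w, N (w - z) < r -> N (f w - f z - l * (w - z)) <= e * N (w - z).
Proof.
have E h : h != 0 -> N (h^-1 *: ((f \o shift z) (h *: (1:C)) - f z) - l) =
    N (f (h + z) - f z - l * h) / N h.
  move=> h0; rewrite /= -normcV -normcM.
  congr N; rewrite /GRing.scale /= mulr1 mulrBl -mulrA divff// mulr1 mulrC; by [].
have nE (P : C -> Prop) : (\forall h \near 0^', P h) <->
    exists2 r : R, 0 < r & forall h, h != 0 -> N h < r -> P h.
  split=> [[e /= e0 he]|[r r0 hr]].
    have ee : e = (complex.Re e)%:C by rewrite RRe_real // gtr0_real.
    rewrite ee ltcR in e0; exists (complex.Re e) => // h h0 hN.
    by apply: he => //=; rewrite /= sub0r normrN normCE ee ltcR.
  exists r%:C => /=; first by rewrite ltcR.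
  by move=> h /=; rewrite sub0r normrN normCE ltcR => hN h0; exact: hr.
have -> : is_derive z 1 f l <->
    (h^-1 *: ((f \o shift z) (h *: (1:C)) - f z) @[h --> 0^'] --> l).
  split=> [[fz <-]//|H]; have fz : derivable f z 1 by apply/cvg_ex; exists l.
  by apply: DeriveDef => //; exact: (cvg_lim (@norm_hausdorff _ (R[i] : normedModType R[i])) H).
split=> [/cvg_normcP H e e0|H].
  have /nE[r r0 hr] := H e e0; exists r => // w wz.
  have [->|wz0] := eqVneq w z; first by rewrite !subrr mulr0 subr0 normc0 mulr0.
  have h0 : w - z != 0 by rewrite subr_eq0.
  by have := hr _ h0 wz; rewrite E// subrK => /ltW; rewrite ler_pdivrMr ?normc_gt0.
apply/cvg_normcP => e e0; have e20 : 0 < e / 2 by rewrite divr_gt0.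
have [r r0 hr] := H _ e20; apply/nE; exists r => // h h0 hN.
rewrite E// ltr_pdivrMr ?normc_gt0//; have := hr (h + z); rewrite addrK => /(_ hN) /le_lt_trans; apply.
by rewrite ltr_pM2r ?normc_gt0// ltr_pdivrMr// ltr_pMr// ltr1n.
Qed.

End Complex.

(** * Surjectivity of small perturbations of the identity *)

Section NearIdentity.
Context (R : realType).
Local Notation C := R[i].
Local Notation N := (@normc R).

(** Banach iteration for [g z = z + (y - f z)], whose fixed points solve [f u = y]. It contracts by
    [c], and it preserves the closed disc because [N y + c * r <= r]. *)
Lemma near_identity_surj (f : C -> C) (r c : R) : 0 <= c <= 1 / 2 -> f 0 = 0 ->
  (forall z w, N z <= r -> N w <= r -> N (f z - f w - (z - w)) <= c * N (z - w)) ->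
  forall y, N y <= (1 - c) * r -> exists2 u, N u <= r & f u = y.
Proof.
move=> /andP[c0 c12] f0 fN y yr.
have r0 : 0 <= r by have := normc_ge0 y; nra.
pose g z := z + (y - f z).
have gB z w : N z <= r -> N w <= r -> N (g z - g w) <= c * N (z - w).
  move=> zr wr; have := fN z w zr wr; rewrite -normc_opp; congr (N _ <= _); rewrite /g; ring.
have gr z : N z <= r -> N (g z) <= r.
  move=> zr; have N0r : N 0 <= r by rewrite normc0.
  have := gB z 0 zr N0r; rewrite subr0 => H.
  rewrite -[g z](subrK (g 0)) (le_trans (ler_normcD _ _))//.
  have -> : g 0 = y by rewrite /g f0 subr0 add0r.
  have : g 0 = y by rewrite /g f0 subr0 add0r.
  move=> E; rewrite E in H; nra.
pose u n := iter n g 0.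
have ur n : N (u n) <= r by elim: n => [|n IH]; [rewrite normc0|exact: gr].
have uB n k : N (u (n + k)%N - u n) <= c ^+ n * r.
  elim: n => [|n IH]; first by rewrite subr0 expr0 mul1r.
  rewrite addSn; apply: (le_trans (gB _ _ (ur _) (ur _))).
  by rewrite exprS -mulrA ler_wpM2l.
have c1 : `|c| < 1 by rewrite ger0_norm//; lra.
have uC : cvg (u n @[n --> \oo]).
  apply: cvgC_cauchy => e e0.
  (* Two iterates are compared through [u n0], each at cost [c ^+ n0 * r]; the summand 1 keeps the
     denominator positive when [r = 0]. *)
  have e1 : 0 < e / (2 * r + 1) by rewrite divr_gt0// ltr_wpDl// mulr_ge0.
  have /cvgrPdist_lt/(_ _ e1)[n0 _ hn0] := cvg_expr c1.
  exists [set n | (n0 <= n)%N]; first by exists n0.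
  have H n : (n0 <= n)%N -> N (u n - u n0) <= c ^+ n0 * r.
    by move=> n0n; rewrite -(subnKC n0n).
  move=> n m /H Hn /H Hm.
  have := hn0 n0 (leqnn _) => /=; rewrite sub0r normrN ger0_norm ?exprn_ge0//.
  rewrite ltr_pdivlMr ?ltr_wpDl ?mulr_ge0// => hc.
  rewrite -(subrK (u n0) (u n)) -addrA.
  apply: (le_lt_trans (ler_normcD _ _)); rewrite (normc_distC (u n0)).
  have := exprn_ge0 n0 c0; lra.
have /cvg_ex[l /cvg_normcP ul] := uC.
have ul' e : 0 < e -> exists n, N (u n - l) < e /\ N (u n.+1 - l) < e.
  by move=> e0; have [n0 _ h] := ul e e0; exists n0; split; apply: h => /=.
have lr : N l <= r.
  apply/ler_addgt0Pr => e e0; have [n [+ _]] := ul' e e0.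
  rewrite normc_distC => h.
  rewrite -[l](subrK (u n)) (le_trans (ler_normcD _ _))// addrC lerD// ltW//.
exists l => //; apply/eqP; rewrite -subr_eq0 -normc_eq0 eq_le normc_ge0 andbT.
apply/ler_addgt0Pr => e e0; have e2 : 0 < e / 2 by rewrite divr_gt0.
have [n [h1 h2]] := ul' _ e2; rewrite add0r.
have := gB _ _ (ur n) lr; rewrite -/(u n.+1) => h3.
have -> : f l - y = (u n.+1 - g l) - (u n.+1 - l) by rewrite /g; ring.
apply: (le_trans (ler_normcB _ _)).
have : N (u n.+1 - g l) <= 1 / 2 * N (u n - l).
  by apply: (le_trans h3); rewrite ler_wpM2r ?normc_ge0.
have := normc_ge0 (u n - l); lra.
Qed.

End NearIdentity.

(** * Complex differentiability through continuous slopes *)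

Section Caratheodory.
Context (R : realType).
Local Notation C := R[i].
Local Notation N := (@normc R).

Implicit Types (z w a b l : C) (f g : C -> C).

Definition ccont f z := forall e : R, 0 < e -> exists2 r : R, 0 < r &
  forall w, N (w - z) < r -> N (f w - f z) < e.

Lemma ccont_cst a z : ccont (fun=> a) z.
Proof.
by move=> e e0; exists 1 => // w _; rewrite subrr normc0.
Qed.

Lemma ccont_id z : ccont id z.
Proof. by move=> e e0; exists e. Qed.

Lemma ccontD f g z : ccont f z -> ccont g z -> ccont (fun w => f w + g w) z.
Proof.
move=> cf cg e e0; have e20 : 0 < e / 2 by rewrite divr_gt0.
have [r r0 hr] := cf _ e20; have [t t0 ht] := cg _ e20.
exists (Num.min r t); first by rewrite lt_min r0.
move=> w; rewrite lt_min => /andP[/hr h1 /ht h2].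
rewrite opprD addrACA (le_lt_trans (ler_normcD _ _))//; lra.
Qed.

Lemma ccontM f g z : ccont f z -> ccont g z -> ccont (fun w => f w * g w) z.
Proof.
move=> cf cg e e0.
have M0 : 0 < N (f z) + N (g z) + 1 by rewrite ltr_wpDl ?addr_ge0 ?normc_ge0.
set M := N (f z) + N (g z) + 1 in M0.
pose d := Num.min 1 (e / M).
have d0 : 0 < d by rewrite lt_min ltr01 divr_gt0.
have d1 : d <= 1 by rewrite ge_min lexx.
have dM : d * M <= e by rewrite -ler_pdivlMr// ge_min lexx orbT.
have [r r0 hr] := cf _ d0; have [t t0 ht] := cg _ d0.
exists (Num.min r t); first by rewrite lt_min r0.
move=> w; rewrite lt_min => /andP[/hr h1 /ht h2].
rewrite (_ : _ - _ = (f w - f z) * (g w - g z) + (f w - f z) * g z + f z * (g w - g z)); last by ring.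
apply: (le_lt_trans (ler_normcD _ _)).
apply: (le_lt_trans (lerD (ler_normcD _ _) (lexx _))).
rewrite !normcM; rewrite /M in dM.
move: h1 h2 (normc_ge0 (f w - f z)) (normc_ge0 (g w - g z)) (normc_ge0 (f z)) (normc_ge0 (g z)).
set a := N (f w - f z); set b := N (g w - g z); set x := N (f z); set y := N (g z).
move=> ad bd a0 b0 x0 y0.
have : a * b <= a * 1 by rewrite ler_wpM2l// (le_trans (ltW bd)).
have : a * y <= d * y by rewrite ler_wpM2r// ltW.
have : x * b <= x * d by rewrite ler_wpM2l// ltW.
have : (d - a) > 0 by rewrite subr_gt0.
move: dM; rewrite /x /y; nra.
Qed.

Lemma ccont_comp (f g : C -> C) z : ccont g z -> ccont f (g z) -> ccont (f \o g) z.
Proof.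
move=> cg cf e /cf[r r0 hr]; have [t t0 ht] := cg _ r0.
by exists t => // w /ht/hr.
Qed.

(** Replaces limits of quotients by a slope function [phi], so that the product and chain rules
    become polynomial identities plus continuity of [phi]. *)
Lemma caratheodory (f : C -> C) z l : is_derive z 1 f l <-> exists phi : C -> C,
  [/\ forall w, f w = f z + (w - z) * phi w, phi z = l & ccont phi z].
Proof.
split=> [/derivable_epsP H|[phi [fE <- cphi]]].
  exists (fun w => if w == z then l else (f w - f z) / (w - z)); split.
  - move=> w; case: eqVneq => [->|wz]; first by rewrite subrr mul0r addr0.
    by rewrite mulrC divfK ?subr_eq0// addrC subrK.
  - by rewrite eqxx.
  - move=> e e0; have e20 : 0 < e / 2 by rewrite divr_gt0.
    have [r r0 hr] := H _ e20; exists r => // w wr; rewrite eqxx.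
    case: eqVneq => [_|wz]; first by rewrite subrr normc0.
    have d0 : w - z != 0 by rewrite subr_eq0.
    rewrite (_ : _ - _ = (f w - f z - l * (w - z)) / (w - z)); last first.
      by rewrite [RHS]mulrBl mulfK.
    rewrite normcM normcV ltr_pdivrMr ?normc_gt0//.
    apply: (le_lt_trans (hr _ wr)); rewrite ltr_pM2r ?normc_gt0//; lra.
apply/derivable_epsP => e /cphi[r r0 hr]; exists r => // w /hr wr.
rewrite fE (_ : _ - _ = (phi w - phi z) * (w - z)); last by ring.
by rewrite normcM ler_wpM2r ?normc_ge0// ltW.
Qed.

Lemma is_derive_ccont (f : C -> C) z l : is_derive z 1 f l -> ccont f z.
Proof.
move=> /caratheodory[phi [fE _ cphi]].
rewrite (_ : f = fun w => f z + (w + - z) * phi w); last by apply/funext => w.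
apply: ccontD; first exact: ccont_cst.
apply: ccontM => //; apply: ccontD; [exact: ccont_id|exact: ccont_cst].
Qed.

Lemma derivableC_is_derive (f : C -> C) z : derivable f z 1 -> is_derive z 1 f ('D_1 f z).
Proof. by move=> fz; apply: DeriveDef. Qed.

Lemma is_derive_derivableC (f : C -> C) z l : is_derive z 1 f l -> derivable f z 1.
Proof. by case. Qed.

Lemma is_deriveC_mul (f g : C -> C) z a b : is_derive z 1 f a -> is_derive z 1 g b ->
  is_derive z 1 (fun w => f w * g w) (a * g z + f z * b).
Proof.
move=> df dg; have cg := is_derive_ccont dg.
move: df dg => /caratheodory[phi [fE <- cphi]] /caratheodory[psi [gE <- cpsi]].
apply/caratheodory; exists (fun w => phi w * g w + f z * psi w); split=> //.
  by move=> w; rewrite mulrDr mulrA (mulrCA (w - z) (f z)) [in LHS]fE mulrDl [X in f z * X]gE; ring.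
apply: ccontD; apply: ccontM => //; exact: ccont_cst.
Qed.

Lemma is_deriveC_add (f g : C -> C) z a b : is_derive z 1 f a -> is_derive z 1 g b ->
  is_derive z 1 (fun w => f w + g w) (a + b).
Proof.
move=> /caratheodory[phi [fE <- cphi]] /caratheodory[psi [gE <- cpsi]].
apply/caratheodory; exists (fun w => phi w + psi w); split=> //.
  by move=> w; rewrite [in LHS]fE [in LHS]gE; ring.
exact: ccontD.
Qed.

Lemma is_deriveC_cst a z : is_derive z 1 (fun=> a : C) (0 : C).
Proof.
apply/caratheodory; exists (fun=> 0); split=> //; last exact: ccont_cst.
by move=> w; rewrite mulr0 addr0.
Qed.

Lemma is_deriveC_id z : is_derive z 1 (id : C -> C) (1 : C).
Proof.
apply/caratheodory; exists (fun=> 1); split=> //; last exact: ccont_cst.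
by move=> w; rewrite mulr1 addrC subrK.
Qed.

Lemma is_deriveC_comp (f g : C -> C) z a b : is_derive (g z) 1 f a -> is_derive z 1 g b ->
  is_derive z 1 (f \o g) (a * b).
Proof.
move=> df dg; have cg := is_derive_ccont dg.
move: df dg => /caratheodory[phi [fE <- cphi]] /caratheodory[psi [gE <- cpsi]].
apply/caratheodory; exists (fun w => phi (g w) * psi w); split=> //.
  move=> w /=; rewrite [in LHS]fE; congr (_ + _).
  have -> : g w - g z = (w - z) * psi w by rewrite gE addrC addKr.
  by rewrite -mulrA (mulrC (psi w)).
by apply: ccontM => //; apply: (ccont_comp cg).
Qed.

Lemma entire_horner (p : {poly C}) : entire (fun z => p.[z]).
Proof.
move=> z; suff [l /is_derive_derivableC //] : exists l, is_derive z 1 (fun z => p.[z]) l.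
elim/poly_ind: p => [|p c [l IH]].
  exists 0; rewrite (_ : (fun _ => _) = (fun=> 0)); first exact: is_deriveC_cst.
  by apply/funext => w; rewrite horner0.
eexists; rewrite (_ : (fun _ => _) = (fun w => p.[w] * w + c)).
  exact: (is_deriveC_add (is_deriveC_mul IH (is_deriveC_id z)) (is_deriveC_cst c z)).
by apply/funext => w; rewrite !hornerE.
Qed.

Lemma entire_cst (a : C) : entire (fun=> a).
Proof. by move=> z; apply: is_derive_derivableC; exact: is_deriveC_cst. Qed.

Lemma entireM (f g : C -> C) : entire f -> entire g -> entire (fun w => f w * g w).
Proof.
move=> ef eg z; have df := derivableC_is_derive (ef z); have dg := derivableC_is_derive (eg z).
exact: (is_derive_derivableC (is_deriveC_mul df dg)).
Qed.

Lemma entireX (f : C -> C) m : entire f -> entire (fun w => f w ^+ m).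
Proof.
move=> ef; elim: m => [|m IH].
  by rewrite (_ : (fun _ => _) = (fun=> 1)); [exact: entire_cst|apply/funext => w; rewrite expr0].
rewrite (_ : (fun _ => _) = (fun w => f w * f w ^+ m)); first exact: entireM.
by apply/funext => w; rewrite exprS.
Qed.

Lemma entire_comp (f g : C -> C) : entire f -> entire g -> entire (fun w => f (g w)).
Proof.
move=> ef eg z; have df := derivableC_is_derive (ef (g z)); have dg := derivableC_is_derive (eg z).
exact: (is_derive_derivableC (is_deriveC_comp df dg)).
Qed.

Lemma is_deriveC_scale (c z : C) : is_derive z 1 (fun w => c * w) c.
Proof.
have := is_deriveC_mul (is_deriveC_cst c z) (is_deriveC_id z).
by rewrite mul0r add0r mulr1.
Qed.

Lemma is_deriveC_subV (a z : C) : z != a ->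
  is_derive z 1 (fun w => (w - a)^-1) (- (z - a)^-2).
Proof.
move=> za; have za0 : z - a != 0 by rewrite subr_eq0.
apply/derivable_epsP => e e0; pose m := N (z - a).
have m0 : 0 < m by rewrite normc_gt0.
(* The first bound keeps [w] at distance at least [m / 2] from [a]; the second compensates the
   denominator, which is then at least [m / 2 * m ^+ 2]. *)
exists (Num.min (m / 2) (e * m ^+ 3 / 2)); first by rewrite lt_min !divr_gt0// mulr_gt0// exprn_gt0.
move=> w; rewrite lt_min => /andP[w1 w2].
have wam : m / 2 <= N (w - a).
  have := ler_normcB (w - a) (w - z).
  by rewrite (_ : w - a - (w - z) = z - a); [rewrite -/m; lra|ring].
have wa : w - a != 0 by rewrite -normc_gt0 (lt_le_trans _ wam)// divr_gt0.
have -> : (w - a)^-1 - (z - a)^-1 - - (z - a)^-2 * (w - z) =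
   (w - z) / ((w - a) * (z - a) ^+ 2) * (w - z) by field; rewrite za0 wa.
rewrite normcM ler_wpM2r ?normc_ge0//.
rewrite normcM normcV.
rewrite normcM normcX -/m ler_pdivrMr ?mulr_gt0 ?exprn_gt0 ?normc_gt0//.
apply: (le_trans (ltW w2)); rewrite -mulrA ler_wpM2l ?(ltW e0)//.
have -> : m ^+ 3 / 2 = m / 2 * m ^+ 2 by rewrite !exprS; ring.
by rewrite ler_wpM2r// exprn_ge0// ltW.
Qed.

Lemma ccont_eq f g z : ccont f z -> ccont g z -> (forall w, w != z -> f w = g w) -> f z = g z.
Proof.
move=> cf cg fg; apply/eqP; rewrite -subr_eq0 -normc_eq0 eq_le normc_ge0 andbT.
apply/ler_addgt0Pr => e e0; have e20 : 0 < e / 2 by rewrite divr_gt0.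
have [r r0 hr] := cf _ e20; have [t t0 ht] := cg _ e20.
pose m := Num.min r t / 2; have mrt : 0 < Num.min r t by rewrite lt_min r0.
have m0 : 0 < m by rewrite divr_gt0.
pose w := z + m%:C; have wz : N (w - z) = m.
  by rewrite /w addrC addKr normc_real ger0_norm// ltW.
have mr : m < Num.min r t by rewrite ltr_pdivrMr// ltr_pMr// ltr1n.
have {}hr := hr w; have {}ht := ht w; move: mr; rewrite -wz lt_min => /andP[/hr h1 /ht h2].
have wnz : w != z by rewrite -subr_eq0 -normc_gt0 wz.
rewrite add0r (_ : f z - g z = (g w - g z) - (f w - f z)); last by rewrite (fg w wnz); ring.
apply: (le_trans (ler_normcB _ _)); lra.
Qed.

Lemma dnbhs0_normc (r : R) : 0 < r -> \forall h \near (0 : C)^', h != 0 /\ N h < r.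
Proof.
move=> r0; exists r%:C => /=; first by rewrite ltcR.
by move=> h /=; rewrite sub0r normrN normCE ltcR.
Qed.

(** The slope [c] may vary with [e]: near 0 all difference quotients lie within [e] of it, hence
    within [2 * e] of each other, and completeness supplies the derivative. This serves when no
    formula for the derivative is at hand. *)
Lemma derivableC_cauchy f z : (forall e : R, 0 < e -> exists c, exists2 r : R, 0 < r &
    forall h, h != 0 -> N h < r -> N (f (h + z) - f z - c * h) <= e * N h) ->
  derivable f z 1.
Proof.
move=> H; apply: cvgC_cauchy => e e0; have e40 : 0 < e / 4 by rewrite divr_gt0.
have [c [r r0 hr]] := H _ e40; exists [set h | h != 0 /\ N h < r]; first exact: dnbhs0_normc.
have B h : h != 0 -> N h < r -> N (h^-1 *: ((f \o shift z) (h *: (1 : C)) - f z) - c) <= e / 4.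
  move=> h0 /(hr _ h0); rewrite -ler_pdivrMr ?normc_gt0// -normcV -normcM.
  congr (N _ <= _); rewrite /= /GRing.scale /= mulr1 mulrBl mulfK//; by rewrite mulrC.
move=> x y [x0 xr] [y0 yr]; have := B _ x0 xr; have := B _ y0 yr.
set X := _ *: _; set Y := _ *: _ => hx hy.
rewrite (_ : Y - X = (Y - c) - (X - c)); last by ring.
apply: (le_lt_trans (ler_normcB _ _)); lra.
Qed.

Lemma derivable_near_eq f g z (r : R) : 0 < r ->
  (forall w, N (w - z) < r -> f w = g w) -> derivable f z 1 -> derivable g z 1.
Proof.
move=> r0 fg /derivableC_is_derive/derivable_epsP H.
apply: (@is_derive_derivableC _ _ ('D_1 f z)); apply/derivable_epsP => e /H[r' r'0 h].
exists (Num.min r r'); first by rewrite lt_min r0.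
move=> w; rewrite lt_min => /andP[wr wr']; rewrite -!fg// ?subrr ?normc0//.
exact: h.
Qed.

End Caratheodory.

(** * Divided differences of polynomials and products of factors near 1 *)

Section LocalTheory.
Context (R : realType).
Local Notation C := R[i].
Local Notation N := (@normc R).
Implicit Types (z w : C).

Lemma divided_difference (p : {poly C}) : exists (D : C -> C -> C) (K : R),
  [/\ 0 <= K, forall a b, p.[a] - p.[b] = (a - b) * D a b,
   forall a b a' b', N a <= 1 -> N b <= 1 -> N a' <= 1 -> N b' <= 1 ->
     N (D a b - D a' b') <= K * (N (a - a') + N (b - b')) &
   D 0 0 = p^`().[0]].
Proof.
elim/poly_ind: p => [|p c [D [K [K0 DE DL D0]]]].
  exists (fun=> fun=> 0), 0; split => //.
  - by move=> a b; rewrite !horner0 subrr mulr0.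
  - by move=> *; rewrite subrr mul0r normc0.
  - by rewrite deriv0 horner0.
(* [N (D 0 0) + 2 * K] bounds the old [D] on the unit bidisc; its Lipschitz constant contributes the
   third [K]. *)
exists (fun a b => p.[a] + b * D a b), (N (D 0 0) + 3 * K); split.
- by rewrite addr_ge0 ?normc_ge0 ?mulr_ge0.
- move=> a b; rewrite !hornerE.
  rewrite (_ : _ - _ = (a - b) * p.[a] + b * (p.[a] - p.[b])); last by ring.
  by rewrite DE; ring.
- move=> a b a' b' a1 b1 a1' b1'.
  rewrite (_ : _ - _ = (a - a') * D a a' + (b - b') * D a b + b' * (D a b - D a' b')); last first.
    by rewrite -DE; ring.
  have B x y : N x <= 1 -> N y <= 1 -> N (D x y) <= N (D 0 0) + 2 * K.
    move=> x1 y1; rewrite -[D x y](subrK (D 0 0)).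
    have := DL x y 0 0 x1 y1; rewrite normc0 ler01 !subr0 => /(_ isT isT) H.
    apply: (le_trans (ler_normcD _ _)); nra.
  apply: (le_trans (ler_normcD _ _)); apply: (le_trans (lerD (ler_normcD _ _) (lexx _))).
  rewrite !normcM.
  have := B _ _ a1 a1'; have := B _ _ a1 b1; have := DL _ _ _ _ a1 b1 a1' b1'.
  have := normc_ge0 (a - a'); have := normc_ge0 (b - b').
  have := normc_ge0 b'; have := normc_ge0 (D 0 0); have := normc_ge0 (D a b - D a' b').
  set u := N (a - a'); set v := N (b - b'); set d := N (D 0 0).
  move=> e0 d0 b0 v0 u0 h1 h2 h3.
  have : u * N (D a a') <= u * (d + 2 * K) by rewrite ler_wpM2l.
  have : v * N (D a b) <= v * (d + 2 * K) by rewrite ler_wpM2l.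
  have : N b' * N (D a b - D a' b') <= 1 * N (D a b - D a' b') by rewrite ler_wpM2r.
  nra.
- by rewrite derivD derivM derivX derivC !hornerE.
Qed.

(** The inductions carry the sharper bounds [1 - q ^+ m] and [M * (1 - q ^+ n)]. Their increments,
    proportional to [(1 - q) * q ^+ m], pay for the error of the next factor because
    [4 * c <= 1 - q]. The resulting bounds are uniform in [n]. *)
Lemma prod_near1 (q c eta : R) (a b : nat -> C) : 0 < q < 1 -> 0 <= c <= (1 - q) / 4 -> 0 <= eta ->
  (forall k, N (a k - 1) <= c * q ^+ k) -> (forall k, N (b k - 1) <= c * q ^+ k) ->
  (forall k, N (a k - b k) <= eta * q ^+ k) -> forall n,
  N (\prod_(k < n) b k) <= 2 /\
  N (\prod_(k < n) a k - \prod_(k < n) b k) <= 4 * eta / (1 - q).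
Proof.
move=> /andP[q0 q1] /andP[c0 cq] eta0 a1 b1 ab n.
have q10 : 0 < 1 - q by lra.
have B m : N (\prod_(k < m) b k - 1) <= 1 - q ^+ m.
  elim: m => [|m IH]; first by rewrite big_ord0 subrr normc0 expr0 subrr.
  rewrite big_ord_recr /=; set p := \prod_(i < m) _ in IH *.
  rewrite (_ : _ - _ = (p - 1) * b m + (b m - 1)); last by ring.
  apply: (le_trans (ler_normcD _ _)); rewrite normcM.
  have bm : N (b m) <= 1 + c * q ^+ m.
    rewrite -[b m](subrK 1) (le_trans (ler_normcD _ _))// normc1 addrC lerD2l.
    exact: b1.
  have := b1 m; rewrite exprS; have Q0 : 0 < q ^+ m by rewrite exprn_gt0.
  have Q1 : q ^+ m <= 1 by rewrite exprn_ile1// ltW.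
  set Q := q ^+ m in bm IH Q0 Q1 *.
  move=> h; have := ler_pM (normc_ge0 _) (normc_ge0 _) IH bm.
  nra.
have B2 m : N (\prod_(k < m) b k) <= 2.
  rewrite -[X in N X](subrK 1) (le_trans (ler_normcD _ _))// normc1.
  have := B m; have : 0 < q ^+ m by rewrite exprn_gt0.
  lra.
split=> //; set M := 4 * eta / (1 - q).
have ME : M * (1 - q) = 4 * eta by rewrite /M divfK// gt_eqF.
have M0 : 0 <= M by rewrite /M divr_ge0 ?mulr_ge0// ltW.
suff : N (\prod_(k < n) a k - \prod_(k < n) b k) <= M * (1 - q ^+ n).
  move/le_trans; apply; rewrite ler_piMr// gerBl exprn_ge0// ltW//.
elim: n => [|m IH]; first by rewrite !big_ord0 subrr normc0 expr0 subrr mulr0.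
rewrite !big_ord_recr /=; move: IH (B2 m); set x := \prod_(i < m) _; set y := \prod_(i < m) _ => IH y2.
rewrite (_ : _ - _ = (x - y) * a m + y * (a m - b m)); last by ring.
apply: (le_trans (ler_normcD _ _)); rewrite !normcM.
have am : N (a m) <= 1 + c * q ^+ m.
  rewrite -[a m](subrK 1) (le_trans (ler_normcD _ _))// normc1 addrC lerD2l.
  exact: a1.
have := ab m; rewrite exprS; have Q0 : 0 < q ^+ m by rewrite exprn_gt0.
have Q1 : q ^+ m <= 1 by rewrite exprn_ile1// ltW.
set Q := q ^+ m in am IH Q0 Q1 *.
move=> h; have h1 := ler_pM (normc_ge0 _) (normc_ge0 _) IH am.
have h2 := ler_pM (normc_ge0 _) (normc_ge0 _) y2 h.
have Mc : M * c <= eta by nra.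
have Mc0 : 0 <= M * c by rewrite mulr_ge0.
have : M * (1 - Q) * (1 + c * Q) + 2 * (eta * Q) <= M * (1 - q * Q).
  have : (M * c) * Q * (1 - Q) <= eta * Q.
    have : (M * c) * (1 - Q) <= eta by nra.
    by move=> h3; rewrite mulrAC ler_wpM2r// ltW.
  have : M * (1 - q * Q) = M * (1 - Q) + 4 * eta * Q by rewrite -ME; ring.
  have : M * (1 - Q) * (1 + c * Q) = M * (1 - Q) + M * c * Q * (1 - Q) by ring.
  have : 0 <= eta * Q by rewrite mulr_ge0// ltW.
  lra.
lra.
Qed.
End LocalTheory.

(** * Poincare functions near the fixed point *)

Section Poincare.
Context (R : realType).
Local Notation C := R[i].
Local Notation N := (@normc R).
Context (P : {poly C}) (lam : R) (f : C -> C).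
Context (lam1 : 1 < lam) (P'0 : P^`().[0] = lam%:C).
Context (fE : forall z, f (lam%:C * z) = P.[f z]) (f0 : f 0 = 0).
Context (f'0 : is_derive (0 : C) (1 : C) f (1 : C)).

Let q := lam^-1.
Let lam0 : 0 < lam. Proof. exact: lt_trans lam1. Qed.
Let q01 : 0 < q < 1. Proof. by rewrite invr_gt0 lam0 invf_lt1. Qed.
Let q0 : 0 < q. Proof. by have /andP[] := q01. Qed.
Let q1 : q < 1. Proof. by have /andP[] := q01. Qed.
Let s n (z : C) : C := (q ^+ n)%:C * z.
Let lamC0 : lam%:C != 0 :> C.
Proof. by rewrite -normc_gt0 normc_real normr_gt0 gt_eqF. Qed.

Let sN n z : N (s n z) = q ^+ n * N z.
Proof.
by rewrite normcM normc_real ger0_norm// exprn_ge0// ltW.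
Qed.

Let sN_le n z : N (s n z) <= N z.
Proof. by rewrite sN ler_piMl ?normc_ge0// exprn_ile1// ltW. Qed.

Let fs n z : f (s n z) = P.[f (s n.+1 z)].
Proof.
rewrite -fE; congr f; rewrite /s exprS rmorphM /= mulrA; congr (_ * _).
by rewrite mulrA /q fmorphV divff// mul1r.
Qed.

Let fsub n z w := (lam ^+ n)%:C * (f (s n z) - f (s n w)).

(** At scale [q ^+ n] only the linear part of [f] at 0 survives, and its slope is 1. The error is
    [e / M] relative to [N z] and to [N w], whose sum is below [M]. *)
Lemma fsub_cvg z w (e : R) : 0 < e -> exists n0, forall n, (n0 <= n)%N ->
  N (fsub n z w - (z - w)) <= e.
Proof.
move=> e0; pose M := N z + N w + 1.
have M0 : 0 < M by rewrite ltr_wpDl ?addr_ge0 ?normc_ge0.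
have [r r0 hr] := (derivable_epsP f 0 1).1 f'0 (e / M) (divr_gt0 e0 M0).
have [n0 hn0] : exists n0, forall n, (n0 <= n)%N -> q ^+ n * M < r.
  have := @cvg_expr R q; rewrite ger0_norm ?(ltW q0)// => /(_ q1)/cvgrPdist_lt.
  move=> /(_ _ (divr_gt0 r0 M0)) [n0 _ h]; exists n0 => n /h /=.
  by rewrite sub0r normrN ger0_norm ?exprn_ge0 ?(ltW q0)// ltr_pdivlMr.
exists n0 => n /hn0 qr.
have B u : N u <= N z + N w -> N ((lam ^+ n)%:C * f (s n u) - u) <= e / M * N u.
  move=> uM; have := hr (s n u); rewrite f0 !subr0 mul1r sN => H.
  have -> : (lam ^+ n)%:C * f (s n u) - u = (lam ^+ n)%:C * (f (s n u) - s n u).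
    rewrite mulrBr /s mulrA -rmorphM /= -exprMn /q divff ?gt_eqF// expr1n.
    by rewrite mul1r.
  rewrite normcM normc_real ger0_norm ?exprn_ge0 ?(ltW lam0)//.
  have {}H : N (f (s n u) - s n u) <= e / M * (q ^+ n * N u).
    apply: H; apply: le_lt_trans qr; rewrite ler_wpM2l ?exprn_ge0 ?(ltW q0)//.
    by rewrite (le_trans uM)// lerDl.
  have lq : lam ^+ n * q ^+ n = 1 by rewrite -exprMn /q divff ?gt_eqF// expr1n.
  have L0 : 0 <= lam ^+ n by rewrite exprn_ge0// ltW.
  apply: (le_trans (ler_wpM2l L0 H)).
  by rewrite mulrCA (mulrA (lam ^+ n)) lq mul1r.
have -> : fsub n z w - (z - w) =
    ((lam ^+ n)%:C * f (s n z) - z) - ((lam ^+ n)%:C * f (s n w) - w).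
  by rewrite /fsub; ring.
apply: (le_trans (ler_normcB _ _)).
have hz := B z; have hw := B w.
have := hz _; rewrite lerDl normc_ge0 => /(_ isT) {}hz.
have := hw _; rewrite lerDr normc_ge0 => /(_ isT) {}hw.
apply: (le_trans (lerD hz hw)); rewrite -mulrDr -mulrA ler_piMr ?(ltW e0)//.
by rewrite mulrC ler_pdivrMr// mul1r /M lerDl.
Qed.

(** No infinite product is formed: the bounds on the finite products are uniform in [n], and [n] is
    chosen last, for each additive error [e]. The first estimate compares the factors with 1; the
    second compares the factors of [z] with those of [z'], and later makes the difference quotients
    differentiable. *)
Lemma local_estimates : exists r1 K : R, [/\ 0 < r1, 0 <= K, K * r1 <= 1 / 2,
  forall r z w, r <= r1 -> N z <= r -> N w <= r ->
    N (f z - f w - (z - w)) <= K * r * N (z - w) &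
  forall z z' w, N z <= r1 -> N z' <= r1 -> N w <= r1 -> z != w -> z' != w ->
    N ((f z - f w) / (z - w) - (f z' - f w) / (z' - w)) <= K * N (z - z')].
Proof.
have [D [K [K0 DE DL D0]]] := divided_difference P.
have [r0 r00 hr0] := (derivable_epsP f 0 1).1 f'0 1 ltr01.
have f2 z : N z < r0 -> N (f z) <= 2 * N z.
  move=> zr; have := hr0 z; rewrite f0 !subr0 mul1r => /(_ zr) H.
  rewrite -[f z](subrK z) (le_trans (ler_normcD _ _))//.
  by rewrite mulr_natl mulr2n lerD2r -[leRHS]mul1r.
(* Ratio of the increments of [f] at scales [k] and [k.+1], divided by [lam]. It tends to 1
   geometrically, since [D 0 0 = lam] and the arguments of [D] are of order [q ^+ k]. *)
pose a z w k := D (f (s k.+1 z)) (f (s k.+1 w)) / lam%:C.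
have rep n z w : f z - f w = (\prod_(k < n) a z w k) * fsub n z w.
  elim: n => [|n IH].
    by rewrite big_ord0 mul1r /fsub /s !expr0 !mul1r.
  rewrite IH big_ord_recr /= -mulrA; congr (_ * _).
  rewrite /fsub (fs n z) (fs n w) DE /a exprS rmorphM /=.
  have e1 : lam%:C * lam%:C^-1 = 1 :> C by rewrite divff.
  set x := f _; set y := f _; set L := (lam ^+ n)%:C.
  rewrite -[LHS]mul1r -[X in X * _ = _]e1; ring.
(* Two values of [4 * eta / (1 - q)] from [prod_near1]: [eta = 4 * K * r] against the constant 1,
   and [eta = 2 * K * N (z - z')] between two products. *)
pose K1 := 16 * K / (1 - q) + 8 * K / (1 - q).
have q10 : 0 < 1 - q by rewrite subr_gt0.
have K'0 : 0 <= 8 * K / (1 - q) by rewrite divr_ge0 ?mulr_ge0// ltW.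
have K10 : 0 <= K1 by rewrite addr_ge0// divr_ge0 ?mulr_ge0// ltW.
(* In order: validity of [f2]; values of [f] in the unit disc, where [D] is Lipschitz; the
   hypothesis on [c = 4 * K * r1] in [prod_near1]; and [K1 * r1 <= 1 / 2]. *)
pose r1 := Num.min (Num.min (r0 / 2) (1 / 2)) (Num.min ((1 - q) / (16 * K + 1)) (1 / (2 * K1 + 2))).
have r10 : 0 < r1.
  rewrite !lt_min !divr_gt0// ?ltr_wpDl ?mulr_ge0//.
have r1r0 : r1 < r0.
  by apply: (@le_lt_trans _ _ (r0 / 2)); [rewrite !ge_min lexx|rewrite ltr_pdivrMr// ltr_pMr// ltr1n].
have r1h : 2 * r1 <= 1.
  have : r1 <= 1 / 2 by rewrite !ge_min lexx !orbT.
  lra.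
have r1K : 4 * K * r1 <= (1 - q) / 4.
  have : r1 <= (1 - q) / (16 * K + 1) by rewrite !ge_min lexx !orbT.
  rewrite ler_pdivlMr ?ltr_wpDl ?mulr_ge0// => h.
  lra.
have r1K1 : K1 * r1 <= 1 / 2.
  have : r1 <= 1 / (2 * K1 + 2) by rewrite !ge_min lexx !orbT.
  rewrite ler_pdivlMr ?ltr_wpDl ?mulr_ge0// => h.
  lra.
have fs1 r z k : r <= r1 -> N z <= r -> N (f (s k.+1 z)) <= 2 * r * q ^+ k /\ N (f (s k.+1 z)) <= 1.
  move=> rr zr; have r0' : 0 <= r := le_trans (normc_ge0 z) zr.
  have H : N (f (s k.+1 z)) <= 2 * (q ^+ k.+1 * N z).
    rewrite -sN f2// (le_lt_trans _ r1r0)// (le_trans (sN_le _ _))// (le_trans zr)//.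
  have H2 : q ^+ k.+1 * N z <= q ^+ k * r.
    rewrite exprS ler_pM ?mulr_ge0 ?exprn_ge0 ?(ltW q0) ?normc_ge0//.
    by rewrite ler_piMl ?exprn_ge0 ?(ltW q0) ?(ltW q1).
  have H3 : q ^+ k * r <= r by rewrite ler_piMl// exprn_ile1 ?(ltW q0) ?(ltW q1).
  split; nra.
have aN r z w : r <= r1 -> N z <= r -> N w <= r -> forall k,
    N (a z w k - 1) <= 4 * K * r * q ^+ k.
  move=> rr zr wr k; have [zk z1] := fs1 _ _ k rr zr; have [wk w1] := fs1 _ _ k rr wr.
  have -> : a z w k - 1 = (D (f (s k.+1 z)) (f (s k.+1 w)) - D 0 0) / lam%:C.
    by rewrite D0 P'0 mulrBl divff.
  rewrite normcM normcV normc_real ger0_norm ?(ltW lam0)//.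
  rewrite ler_pdivrMr//.
  have := DL (f (s k.+1 z)) (f (s k.+1 w)) 0 0; rewrite normc0 !subr0 ler01.
  move=> /(_ z1 w1 isT isT) H.
  have H' : K * (N (f (s k.+1 z)) + N (f (s k.+1 w))) <= 4 * K * r * q ^+ k.
    by rewrite (_ : _ * q ^+ k = K * (2 * r * q ^+ k + 2 * r * q ^+ k)); [rewrite ler_wpM2l// lerD|ring].
  apply: (le_trans H); apply: (le_trans H'); rewrite ler_peMr ?(ltW lam1)//.
  by rewrite !mulr_ge0 ?exprn_ge0 ?(ltW q0)// (le_trans (normc_ge0 z)).
have aN1 z w : N z <= r1 -> N w <= r1 -> forall k, N (a z w k - 1) <= 4 * K * r1 * q ^+ k.
  by move=> *; apply: aN.
have c01 : 0 <= 4 * K * r1 <= (1 - q) / 4 by rewrite r1K andbT !mulr_ge0// ltW.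
have strict r z w : r <= r1 -> N z <= r -> N w <= r ->
    N (f z - f w - (z - w)) <= 16 * K / (1 - q) * r * N (z - w).
  move=> rr zr wr; have r0' : 0 <= r := le_trans (normc_ge0 z) zr.
  have c0 : 0 <= 4 * K * r <= (1 - q) / 4.
    by rewrite !mulr_ge0//=; apply: le_trans r1K; rewrite ler_wpM2l// mulr_ge0.
  set M := _ * r.
  have M0 : 0 <= M by rewrite /M mulr_ge0// divr_ge0 ?mulr_ge0// ltW.
  apply/ler_addgt0Pr => e e0.
  have e1 : 0 < e / (M + 1) by rewrite divr_gt0// ltr_wpDl.
  have [n0 /(_ n0 (leqnn _))] := fsub_cvg z w e1.
  set L := fsub _ _ _ => HL.
  (* With all [b k = 1], the second bound of [prod_near1] compares the product with 1. *)
  have P1 : N (\prod_(k < n0) a z w k - 1) <= M.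
    have [] := @prod_near1 R q (4 * K * r) (4 * K * r) (a z w) (fun=> 1) q01 c0 _
      (aN _ _ _ rr zr wr) _ _ n0.
    - by rewrite !mulr_ge0.
    - by move=> k; rewrite subrr normc0 !mulr_ge0 ?exprn_ge0 ?(ltW q0).
    - exact: (aN _ _ _ rr zr wr).
    - rewrite big1// => _ /le_trans; apply; rewrite /M le_eqVlt; apply/orP; left; apply/eqP; ring.
  rewrite (rep n0 z w) -/L.
  rewrite (_ : _ - _ = (\prod_(k < n0) a z w k - 1) * (z - w) +
    (\prod_(k < n0) a z w k - 1) * (L - (z - w)) + (L - (z - w))); last by ring.
  apply: (le_trans (ler_normcD _ _)); apply: (le_trans (lerD (ler_normcD _ _) HL)).
  rewrite !normcM -addrA lerD// ?ler_wpM2r ?normc_ge0//.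
  have := ler_pM (normc_ge0 _) (normc_ge0 _) P1 HL.
  have : M * (e / (M + 1)) + e / (M + 1) = e.
    rewrite -[X in _ + X]mul1r -mulrDl mulrC divfK// gt_eqF// ltr_wpDl//.
  by lra.
exists r1, K1; split => //.
  move=> r z w rr zr wr; apply: (le_trans (strict _ _ _ rr zr wr)).
  rewrite ler_wpM2r ?normc_ge0// ler_wpM2r ?(le_trans (normc_ge0 z))//.
  by rewrite /K1 lerDl.
have lip2 z w : N z <= r1 -> N w <= r1 -> N (f z - f w) <= 2 * N (z - w).
  move=> zr wr; have := strict _ _ _ (lexx r1) zr wr.
  move=> h; rewrite -[leLHS]/(N _) -[f z - f w](subrK (z - w)); apply: (le_trans (ler_normcD _ _)).
  have : 16 * K / (1 - q) * r1 <= 1 by rewrite /K1 in r1K1; nra.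
  have := normc_ge0 (z - w); nra.
move=> z z' w zr zr' wr zw zw'.
apply/ler_addgt0Pr => e e0.
have dz : z - w != 0 by rewrite subr_eq0.
have dz' : z' - w != 0 by rewrite subr_eq0.
(* Errors relative to the increments: after division they are [e / 4], and each is multiplied by a
   product of modulus at most 2. *)
pose e1 := e * N (z - w) / 4; pose e2 := e * N (z' - w) / 4.
have e10 : 0 < e1 by rewrite divr_gt0// mulr_gt0// normc_gt0.
have e20 : 0 < e2 by rewrite divr_gt0// mulr_gt0// normc_gt0.
have [n1 H1] := fsub_cvg z w e10; have [n2 H2] := fsub_cvg z' w e20.
pose n := maxn n1 n2.
have {}H1 := H1 n (leq_maxl _ _); have {}H2 := H2 n (leq_maxr _ _).
have eta0 : 0 <= 2 * K * N (z - z') by rewrite !mulr_ge0 ?normc_ge0.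
have ab k : N (a z w k - a z' w k) <= 2 * K * N (z - z') * q ^+ k.
  have [_ z1] := fs1 _ _ k (lexx _) zr; have [_ w1] := fs1 _ _ k (lexx _) wr.
  have [_ z1'] := fs1 _ _ k (lexx _) zr'.
  rewrite -mulrBl normcM normcV normc_real ger0_norm ?(ltW lam0)//.
  rewrite ler_pdivrMr//; apply: (le_trans (DL _ _ _ _ z1 w1 z1' w1)).
  rewrite subrr normc0 addr0.
  have H : N (f (s k.+1 z) - f (s k.+1 z')) <= 2 * (q ^+ k * N (z - z')).
    apply: (le_trans (lip2 _ _ (le_trans (sN_le _ _) zr) (le_trans (sN_le _ _) zr'))).
    rewrite ler_wpM2l// -mulrBr -/(s k.+1 (z - z')) sN ler_wpM2r ?normc_ge0//.
    by rewrite exprS ler_piMl ?exprn_ge0 ?(ltW q0) ?(ltW q1).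
  apply: (le_trans (ler_wpM2l K0 H)).
  rewrite (_ : K * _ = 2 * K * N (z - z') * q ^+ k); last by ring.
  by rewrite ler_peMr ?(ltW lam1)// mulr_ge0 ?exprn_ge0 ?(ltW q0).
have [B' B] := prod_near1 q01 c01 eta0 (aN1 _ _ zr wr) (aN1 _ _ zr' wr) ab n.
(* [prod_near1] bounds only the product of its second family, so it is applied again with the roles
   exchanged. *)
have ba k : N (a z' w k - a z w k) <= 2 * K * N (z - z') * q ^+ k.
  by rewrite normc_distC; exact: ab.
have [A2 _] := prod_near1 q01 c01 eta0 (aN1 _ _ zr' wr) (aN1 _ _ zr wr) ba n.
have quot x d : d != 0 -> N (fsub n x w - d) <= e * N d / 4 -> N (fsub n x w / d - 1) <= e / 4.
  move=> d0 H.
  have -> : fsub n x w / d - 1 = (fsub n x w - d) / d by rewrite mulrBl divff.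
  rewrite normcM normcV ler_pdivrMr ?normc_gt0//.
  by rewrite mulrAC.
have {}H1 := quot _ _ dz H1; have {}H2 := quot _ _ dz' H2.
rewrite (rep n z w) (rep n z' w) -(mulrA _ _ (z - w)^-1) -(mulrA _ _ (z' - w)^-1).
move: B' B A2 H1 H2; set A := \prod_(k < n) a z w k; set A' := \prod_(k < n) a z' w k.
set l := _ / (z - w); set l' := _ / (z' - w) => A'2 AA' A2 H1 H2.
rewrite (_ : _ - _ = (A - A') + A * (l - 1) - A' * (l' - 1)); last by ring.
apply: (le_trans (ler_normcB _ _)); apply: (le_trans (lerD (ler_normcD _ _) (lexx _))).
rewrite !normcM.
have := ler_pM (normc_ge0 _) (normc_ge0 _) A2 H1.
have := ler_pM (normc_ge0 _) (normc_ge0 _) A'2 H2.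
have : 4 * (2 * K * N (z - z')) / (1 - q) <= K1 * N (z - z').
  have -> : 4 * (2 * K * N (z - z')) / (1 - q) = 8 * K / (1 - q) * N (z - z') by ring.
  by rewrite ler_wpM2r ?normc_ge0// /K1 lerDr divr_ge0 ?mulr_ge0// ltW.
lra.
Qed.

End Poincare.

(** * Difference quotients of an entire function, across the diagonal *)

Section DifferenceQuotient.
Context (R : realType).
Local Notation C := R[i].
Local Notation N := (@normc R).
Context (f : C -> C) (ef : entire f).

Definition dq (w z : C) : C := if z == w then 'D_1 f w else (f z - f w) / (z - w).

Lemma dqE w z : f z = f w + (z - w) * dq w z.
Proof.
rewrite /dq; case: eqVneq => [->|zw]; first by rewrite subrr mul0r addr0.
by rewrite mulrC divfK ?subr_eq0// addrC subrK.
Qed.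

Lemma dq_ccont w : ccont (dq w) w.
Proof.
have /caratheodory[phi [fE phiw cphi]] := derivableC_is_derive (@ef w).
rewrite (_ : dq w = phi)//; apply/funext => z; rewrite /dq.
case: eqVneq => [->//|zw]; rewrite fE addrC addKr mulrC mulKf// subr_eq0//.
Qed.

Lemma dq_derivable w z : z != w -> derivable (dq w) z 1.
Proof.
move=> zw; have r0 : 0 < N (z - w) by rewrite normc_gt0 subr_eq0.
apply: (derivable_near_eq (f := fun x => (f x + - f w) * (x - w)^-1) r0).
  move=> x xz; rewrite /dq; case: eqVneq => // xw.
  by move: xz; rewrite xw normc_distC ltxx.
exact: (is_derive_derivableC (is_deriveC_mul (is_deriveC_add (derivableC_is_derive (@ef z))
  (is_deriveC_cst _ z)) (is_deriveC_subV zw))).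
Qed.

Context (r1 K : R) (K0 : 0 <= K).
Context (fid : forall z w, N z <= r1 -> N w <= r1 ->
  N (f z - f w - (z - w)) <= 1 / 2 * N (z - w)).
Context (flip : forall z z' w, N z <= r1 -> N z' <= r1 -> N w <= r1 -> z != w -> z' != w ->
    N ((f z - f w) / (z - w) - (f z' - f w) / (z' - w)) <= K * N (z - z')).

(** [flip] speaks of points off the diagonal; the value at [w] is reached by continuity, through a
    point [x] at a small distance [m] from [w]. *)
Lemma dq_lip w z : N w < r1 -> N z <= r1 -> N (dq w z - dq w w) <= K * N (z - w).
Proof.
move=> wr zr; have [->|zw] := eqVneq z w.
  by rewrite !subrr normc0 mulr0.
apply/ler_addgt0Pr => e e0.
have e1 : 0 < e / (K + 1) by rewrite divr_gt0// ltr_wpDl.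
have [r r0 hr] := dq_ccont w e1.
pose m := Num.min (Num.min r (r1 - N w)) (e / (K + 1)) / 2.
have M0 : 0 < Num.min (Num.min r (r1 - N w)) (e / (K + 1)) by rewrite !lt_min r0 subr_gt0 wr.
have m0 : 0 < m by rewrite divr_gt0.
have : m < Num.min (Num.min r (r1 - N w)) (e / (K + 1)) by rewrite ltr_pdivrMr// ltr_pMr// ltr1n.
rewrite !lt_min => /andP[/andP[mr m1] me].
pose x := w + m%:C; have xw : N (x - w) = m.
  by rewrite /x addrC addKr normc_real ger0_norm// ltW.
have xnw : x != w by rewrite -subr_eq0 -normc_gt0 xw.
have xr : N x <= r1.
  by rewrite -(subrK w x) (le_trans (ler_normcD _ _))// xw; lra.
have h1 := hr x; rewrite xw in h1; have {}h1 := h1 mr.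
have h2 := flip zr xr (ltW wr) zw xnw.
have -> : dq w z - dq w w = (dq w z - dq w x) + (dq w x - dq w w) by ring.
apply: (le_trans (ler_normcD _ _)).
have h3 : N (dq w z - dq w x) <= K * N (z - x) by rewrite /dq (negPf zw) (negPf xnw).
have h4 : N (z - x) <= N (z - w) + m.
  by rewrite -xw (normc_distC x) (_ : z - x = (z - w) + (w - x)) ?ler_normcD//; ring.
have h5 : K * N (z - x) <= K * (N (z - w) + m) by rewrite ler_wpM2l.
have : (K + 1) * (e / (K + 1)) = e by rewrite mulrC divfK// gt_eqF// ltr_wpDl.
have : K * m <= K * (e / (K + 1)) by rewrite ler_wpM2l// ltW.
lra.
Qed.

Lemma dq_near1 w z : N w < r1 -> N z < r1 -> N (dq w z - 1) <= 1 / 2.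
Proof.
move=> wr zr; have [->|zw] := eqVneq z w; last first.
  have := fid (ltW zr) (ltW wr).
  have -> : f z - f w - (z - w) = (z - w) * (dq w z - 1) by rewrite (dqE w z); ring.
  rewrite normcM mulrC ler_pM2r ?normc_gt0 ?subr_eq0//.
apply/ler_addgt0Pr => e e0.
have [r r0 hr] := dq_ccont w e0.
pose m := Num.min r (r1 - N w) / 2.
have M0 : 0 < Num.min r (r1 - N w) by rewrite !lt_min r0 subr_gt0 wr.
have m0 : 0 < m by rewrite divr_gt0.
have : m < Num.min r (r1 - N w) by rewrite ltr_pdivrMr// ltr_pMr// ltr1n.
rewrite !lt_min => /andP[mr m1].
pose x := w + m%:C; have xw : N (x - w) = m.
  by rewrite /x addrC addKr normc_real ger0_norm// ltW.
have xnw : x != w by rewrite -subr_eq0 -normc_gt0 xw.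
have xr : N x <= r1.
  by rewrite -(subrK w x) (le_trans (ler_normcD _ _))// xw; lra.
have h1 := hr x; rewrite xw in h1; have {}h1 := h1 mr.
have h2 : N (dq w x - 1) <= 1 / 2.
  have := fid xr (ltW wr).
  have -> : f x - f w - (x - w) = (x - w) * (dq w x - 1) by rewrite (dqE w x); ring.
  rewrite normcM mulrC ler_pM2r ?normc_gt0 ?subr_eq0//.
rewrite (_ : dq w w - 1 = (dq w x - 1) - (dq w x - dq w w)); last by ring.
apply: (le_trans (ler_normcB _ _)); lra.
Qed.

(* Zooming in by the factor [q ^ n] multiplies the Lipschitz error of the
   difference quotient by [q ^ n], and this is why it is differentiable on the
   diagonal. *)
Lemma dq_entire (q : R) (w : C) : 0 < q < 1 -> N w < r1 ->
  (forall n, exists2 A : C -> C, entire A & forall z, z != w ->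
     dq w z = A z * dq ((q ^+ n)%:C * w) ((q ^+ n)%:C * z)) ->
  entire (dq w).
Proof.
move=> /andP[q0 q1] wr HA z; have [->|zw] := eqVneq z w; last exact: dq_derivable.
apply: derivableC_cauchy => e e0.
have K10 : 0 < 3 * K + 1 by rewrite ltr_wpDl// mulr_ge0.
have [n qn] : exists n, q ^+ n * (3 * K + 1) < e / 2.
  have := @cvg_expr R q; rewrite ger0_norm?(ltW q0)// => /(_ q1)/cvgrPdist_lt.
  have e1 : 0 < e / 2 / (3 * K + 1) by rewrite !divr_gt0.
  move=> /(_ _ e1) [n0 _ /(_ n0 (leqnn _))] h; exists n0.
  by move: h; rewrite /= sub0r normrN ger0_norm ?exprn_ge0 ?(ltW q0)// ltr_pdivlMr.
have [A eA AE] := HA n; pose s x : C := (q ^+ n)%:C * x.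
have qn0 : 0 < q ^+ n by rewrite exprn_gt0.
have sN x : N (s x) = q ^+ n * N x.
  by rewrite normcM normc_real ger0_norm// ltW.
have sr x : N x < r1 -> N (s x) < r1.
  by apply: le_lt_trans; rewrite sN ler_piMl ?normc_ge0// exprn_ile1 ?(ltW q0) ?(ltW q1).
have dA := derivableC_is_derive (eA w).
have cs : ccont s w by exact: is_derive_ccont (is_deriveC_scale _ w).
(* The factorisation is given for [z != w] only; continuity of both sides extends it to [w]. *)
have AEw : dq w w = A w * dq (s w) (s w).
  apply: (@ccont_eq _ (dq w) (fun z => A z * dq (s w) (s z))) => //; first exact: dq_ccont.
  apply: ccontM; first exact: is_derive_ccont dA.
  apply: (@ccont_comp _ (dq (s w)) s) => //; exact: dq_ccont.
have e40 : 0 < e / 4 by rewrite divr_gt0.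
have [r r0 hr] := (derivable_epsP _ _ _).1 dA _ e40.
(* This slope ignores the variation of the zoomed quotient. It depends on [n], hence on [e], which
   [derivableC_cauchy] allows. *)
exists ('D_1 A w * dq (s w) (s w)), (Num.min r (r1 - N w)).
  by rewrite lt_min r0 subr_gt0.
move=> h h0; rewrite lt_min => /andP[hr' hr1].
have xw : h + w != w by rewrite -subr_eq0 addrK.
have xr : N (h + w) < r1 by apply: le_lt_trans (ler_normcD _ _) _; lra.
have := hr (h + w); rewrite addrK => /(_ hr') H1.
have H2 := dq_lip (sr _ wr) (ltW (sr _ xr)); rewrite -mulrBr addrK -/(s h) sN in H2.
(* [A] is a quotient of two values of [dq], the numerator of modulus at most 3/2 and the denominator
   at least 1/2. This bound does not depend on [n], so [n] could be fixed beforehand with the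
   constant [3 * K + 1]. *)
have AN : N (A (h + w)) <= 3.
  have a1 := dq_near1 wr xr; have a2 := dq_near1 (sr _ wr) (sr _ xr).
  have b1 : N (dq w (h + w)) <= 3 / 2.
    rewrite -(subrK 1 (dq w _)) (le_trans (ler_normcD _ _))// normc1; lra.
  have b2 : 1 / 2 <= N (dq (s w) (s (h + w))).
    have := ler_normcB (dq (s w) (s (h + w))) (dq (s w) (s (h + w)) - 1).
    by rewrite opprB addrC subrK normc1; lra.
  have := AE _ xw => /(congr1 N); rewrite normcM -!/(s _) => E.
  have : N (A (h + w)) * (1 / 2) <= 3 / 2 by apply: le_trans b1; rewrite E ler_wpM2l ?normc_ge0.
  lra.
have dn2 : N (dq (s w) (s w)) <= 2.
  have := dq_near1 (sr _ wr) (sr _ wr) => a.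
  rewrite -(subrK 1 (dq (s w) _)) (le_trans (ler_normcD _ _))// normc1; lra.
rewrite AE// AEw -!/(s _).
have alg (a1 a0 x d1 d0 : C) :
    a1 * d1 - a0 * d0 - x * d0 * h = (a1 - a0 - x * h) * d0 + a1 * (d1 - d0) by ring.
rewrite alg.
apply: (le_trans (ler_normcD _ _)); rewrite !normcM.
have h1 := ler_pM (normc_ge0 _) (normc_ge0 _) H1 dn2.
have h2 := ler_pM (normc_ge0 _) (normc_ge0 _) AN H2.
apply: (le_trans (lerD h1 h2)).
rewrite (_ : _ + _ = (e / 2 + q ^+ n * (3 * K)) * N h); last by field.
rewrite ler_wpM2r ?normc_ge0//; lra.
Qed.

End DifferenceQuotient.

(** * Zeros of the Poincare function and roots of the iterates *)

Section RootCount.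
Context (R : realType).
Local Notation C := R[i].
Local Notation N := (@normc R).

Lemma prod_XsubC_count (rs : seq C) (y : C) : exists2 S : {poly C}, S.[y] != 0 &
  \prod_(z <- rs) ('X - z%:P) = ('X - y%:P) ^+ (count_mem y rs) * S.
Proof.
elim: rs => [|z rs [S Sy IH]]; first by exists 1; rewrite ?hornerC ?oner_neq0// big_nil expr0 mul1r.
rewrite big_cons IH /=; case: eqVneq => [->|zy].
  by exists S => //; rewrite add1n exprS mulrA.
exists (('X - z%:P) * S); last by rewrite add0n mulrCA.
by rewrite hornerM mulf_neq0// hornerXsubC subr_eq0 eq_sym.
Qed.

Lemma count_undup (T : eqType) (a : pred T) (rs : seq T) :
  (\sum_(y <- [seq y <- undup rs | a y]) count_mem y rs)%N = count a rs.
Proof.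
rewrite big_filter -sum1_count -(big_undup_iterop_count _ rs a (fun=> 1%N)).
by apply: eq_bigr => y _; elim: (count_mem y rs) => // -[|n] //= IH; rewrite /= -IH.
Qed.

Lemma size_iter_poly (P : {poly C}) n : (1 < size P)%N -> (1 < size (iter_poly P n))%N.
Proof.
move=> P1; elim: n => [|n IH]; first by rewrite size_polyX.
by rewrite /= -ltn_predRL size_comp_poly muln_gt0 !ltn_predRL P1.
Qed.

Lemma roots_seqE (Q : {poly C}) : Q = lead_coef Q *: \prod_(z <- roots_seq Q) ('X - z%:P).
Proof. exact: (svalP (closed_field_poly_normal Q)). Qed.

Lemma mem_roots_seq (Q : {poly C}) y : Q != 0 -> (y \in roots_seq Q) = root Q y.
Proof.
move=> Q0; rewrite {2}(roots_seqE Q) rootZ ?lead_coef_eq0//.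
by rewrite root_prod_XsubC.
Qed.

(** Any exhibited factorisation determines the value of [xget]: if two exponents differed,
    cancelling the smaller power off [z] and letting [w] tend to [z] would make a cofactor vanish at
    [z]. *)
Lemma zero_mult_eq (f g : C -> C) (z : C) (m : nat) : entire g -> g z != 0 ->
  (forall w, f w = (w - z) ^+ m * g w) -> zero_mult f z = m.
Proof.
have aux (g1 g2 : C -> C) m1 m2 : entire g1 -> entire g2 -> g1 z != 0 ->
    (forall w, (w - z) ^+ m1 * g1 w = (w - z) ^+ m2 * g2 w) -> (m2 <= m1)%N.
  move=> e1 e2 gz E; rewrite leqNgt; apply/negP => mm; case/negP: gz; apply/eqP.
  have e3 : entire (fun w => (w - z) ^+ (m2 - m1) * g2 w).
    have eX : entire (fun w => w - z).
      have := @entire_horner R ('X - z%:P).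
      by congr (entire _); apply/funext => w; rewrite hornerXsubC.
    exact: (@entireM _ _ _ (@entireX _ _ (m2 - m1) eX) e2).
  have -> : g1 z = (fun w => (w - z) ^+ (m2 - m1) * g2 w) z.
    apply: (@ccont_eq _ g1 (fun w => (w - z) ^+ (m2 - m1) * g2 w)).
    - exact: is_derive_ccont (derivableC_is_derive (e1 z)).
    - exact: is_derive_ccont (derivableC_is_derive (e3 z)).
    - move=> w wz; have w0 : (w - z) ^+ m1 != 0 by rewrite expf_neq0// subr_eq0.
      by apply: (mulfI w0); rewrite E mulrA -exprD subnKC// ltnW.
  by rewrite subrr expr0n subn_eq0 leqNgt mm mul0r.
move=> eg gz fE; apply: xget_unique; first by exists g.
move=> m' [g' [eg' gz' fE']]; apply/eqP; rewrite eqn_leq; apply/andP; split.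
  by apply: (aux g g') => // w; rewrite -fE.
by apply: (aux g' g) => // w; rewrite -fE -fE'.
Qed.

End RootCount.

Section ZeroCount.
Context (R : realType).
Local Notation C := R[i].
Local Notation N := (@normc R).
Context (P : {poly C}) (lam : R) (f : C -> C).
Context (lam1 : 1 < lam) (P'0 : P^`().[0] = lam%:C) (sP : (1 < size P)%N).
Context (fE : forall z, f (lam%:C * z) = P.[f z]) (f0 : f 0 = 0).
Context (f'0 : is_derive (0 : C) (1 : C) f (1 : C)) (ef : entire f).

Let q := lam^-1.
Let lam0 : 0 < lam. Proof. exact: lt_trans lam1. Qed.
Let q01 : 0 < q < 1. Proof. by rewrite invr_gt0 lam0 invf_lt1. Qed.
Let q0 : 0 < q. Proof. by have /andP[] := q01. Qed.
Let lamC0 : lam%:C != 0 :> C.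
Proof. by rewrite -normc_gt0 normc_real normr_gt0 gt_eqF. Qed.
Let s n (z : C) : C := (q ^+ n)%:C * z.
Let sN n z : N (s n z) = q ^+ n * N z.
Proof.
by rewrite normcM normc_real ger0_norm// exprn_ge0// ltW.
Qed.

Lemma iter_poly_f n z : (iter_poly P n).[f (s n z)] = f z.
Proof.
elim: n z => [|n IH] z; first by rewrite hornerX /s expr0 mul1r.
rewrite /= horner_comp (_ : s n.+1 z = s n (q%:C * z)); last first.
  by rewrite /s exprSr rmorphM mulrA.
by rewrite IH -fE mulrA -rmorphM /q divff ?gt_eqF// mul1r.
Qed.

(* The shape in which [iter_poly P n] occurs in [preimage_measure P 0 n]. *)
Let Q n := iter_poly P n - 0%:P.
Let Q_neq0 n : Q n != 0.
Proof. by rewrite /Q subr0 -size_poly_gt0 ltnW// size_iter_poly. Qed.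
Let Qf n z : (Q n).[f (s n z)] = f z.
Proof. by rewrite /Q subr0 iter_poly_f. Qed.

Context (r1 K : R) (K0 : 0 <= K).
Context (fid : forall z w, N z <= r1 -> N w <= r1 ->
  N (f z - f w - (z - w)) <= 1 / 2 * N (z - w)).
Context (flip : forall z z' w, N z <= r1 -> N z' <= r1 -> N w <= r1 -> z != w -> z' != w ->
    N ((f z - f w) / (z - w) - (f z' - f w) / (z' - w)) <= K * N (z - z')).

Lemma near_id_inj z w : N z <= r1 -> N w <= r1 -> f z = f w -> z = w.
Proof.
move=> zr wr fzw; have := fid zr wr; rewrite fzw subrr sub0r normc_opp => h.
apply/eqP; rewrite -subr_eq0 -normc_eq0 eq_le normc_ge0 andbT; lra.
Qed.

Lemma dq_entire_f w : N w < r1 -> entire (dq f w).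
Proof.
move=> wr; apply: (@dq_entire _ _ ef _ _ K0 fid flip _ _ q01 wr) => n.
(* Evaluated at [f (s n z)], this gives [f z - f w = D.[f (s n z)] * (f (s n z) - f (s n w))]. The
   factor [q ^+ n] in the witness comes from [s n z - s n w]. *)
have /factor_theorem[D QE] : root (Q n - (Q n).[f (s n w)]%:P) (f (s n w)).
  by rewrite /root hornerD hornerN hornerC subrr.
exists (fun z => D.[f (s n z)] * (q ^+ n)%:C).
  have es : entire (s n) by move=> z; exact: (is_derive_derivableC (is_deriveC_scale _ z)).
  exact: (@entireM _ _ _ (@entire_comp _ _ _ (@entire_horner _ D) (@entire_comp _ _ _ ef es))
    (@entire_cst _ _)).
move=> z zw; have d0 : z - w != 0 by rewrite subr_eq0.
apply: (mulfI d0); have -> : (z - w) * dq f w z = f z - f w by rewrite (dqE f w z) [RHS]addrC addKr.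
have : (Q n - (Q n).[f (s n w)]%:P).[f (s n z)] = D.[f (s n z)] * (f (s n z) - f (s n w)).
  by rewrite QE hornerM hornerXsubC.
rewrite hornerD hornerN hornerC !Qf => ->.
rewrite (dqE f (s n w) (s n z)) (addrC (f _)) addrK -mulrBr -/(s n (z - w)) /s; ring.
Qed.

(** The increment of [f \o s n] at [x] is [w - x] times an entire function that does not vanish at
    [x], as [dq] stays within 1/2 of 1. Composing with [Q n] therefore preserves the multiplicity of
    the root; [g] is the explicit cofactor. *)
Lemma zero_mult_count n x : N (s n x) < r1 ->
  zero_mult f x = count_mem (f (s n x)) (roots_seq (Q n)).
Proof.
move=> xr; have [S Sy SE] := prod_XsubC_count (roots_seq (Q n)) (f (s n x)).
set m := count_mem _ _ in SE *.
pose g w := lead_coef (Q n) * ((q ^+ n)%:C * dq f (s n x) (s n w)) ^+ m * S.[f (s n w)].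
have es : entire (s n) by move=> z; exact: (is_derive_derivableC (is_deriveC_scale _ z)).
apply: (@zero_mult_eq _ _ g).
- have ed : entire (fun w => (q ^+ n)%:C * dq f (s n x) (s n w)).
    exact: (@entireM _ _ _ (@entire_cst _ _) (@entire_comp _ _ _ (dq_entire_f xr) es)).
  exact: (@entireM _ _ _ (@entireM _ _ _ (@entire_cst _ _) (@entireX _ _ m ed))
    (@entire_comp _ _ _ (@entire_horner _ S) (@entire_comp _ _ _ ef es))).
- rewrite /g !mulf_neq0 ?expf_neq0 ?lead_coef_eq0// mulf_neq0//.
    by rewrite -normc_gt0 normc_real normr_gt0 expf_neq0// gt_eqF.
  have := @dq_near1 _ _ ef _ fid _ _ xr xr => h; apply/eqP => d0; move: h.
  rewrite d0 sub0r normc_opp normc1; lra.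
- move=> w; rewrite -(Qf n w) {1}(roots_seqE (Q n)) SE hornerZ hornerM horner_exp hornerXsubC.
  have -> : f (s n w) - f (s n x) = (w - x) * ((q ^+ n)%:C * dq f (s n x) (s n w)).
    rewrite {1}(dqE f (s n x) (s n w)) [LHS]addrC addKr -mulrBr mulrA.
    by congr (_ * _); rewrite mulrC.
  have alg (a b c e : C) : a * (b * c * e) = b * (a * c * e) by ring.
  by rewrite exprMn alg.
Qed.

(** The map [f \o s n] identifies the zeros in the disc with finitely many distinct roots; summing
    their multiplicities gives the count with repetition, by [count_undup]. *)
Lemma zero_countE n r : r <= r1 -> zero_count f (lam ^+ n * r) =
  (count (fun y => `[< exists2 u, N u < r & f u = y >]) (roots_seq (Q n)))%:R.
Proof.
move=> rr; set a := (X in count X _); set rs := roots_seq _.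
have lq : lam ^+ n * q ^+ n = 1 by rewrite -exprMn /q divff ?gt_eqF// expr1n.
have sr z : `|z| < (lam ^+ n * r)%:C -> N (s n z) < r.
  rewrite normCE ltcR sN => h.
  by rewrite -(@ltr_pM2l _ (lam ^+ n)) ?exprn_gt0// mulrA lq mul1r.
have bij : set_bij [set z : C | `|z| < (lam ^+ n * r)%:C /\ f z = 0]
    [set` [seq y <- undup rs | a y]] (fun z => f (s n z)).
  split.
  - move=> z /= [/sr zr fz]; rewrite mem_filter mem_undup mem_roots_seq ?Q_neq0// rootE Qf fz eqxx andbT.
    by apply/asboolP; exists (s n z).
  - move=> z w /set_mem[/sr zr _] /set_mem[/sr wr _].
    move=> /(near_id_inj (ltW (lt_le_trans zr rr)) (ltW (lt_le_trans wr rr))).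
    apply: mulfI; by rewrite -normc_gt0 normc_real normr_gt0 expf_neq0// gt_eqF.
  - move=> y /=; rewrite mem_filter mem_undup mem_roots_seq ?Q_neq0// => /andP[/asboolP[u ur <-] /rootP Qu].
    have su : s n ((lam ^+ n)%:C * u) = u by rewrite /s mulrA -rmorphM /= mulrC (mulrC (q ^+ n)) lq mulr1.
    exists ((lam ^+ n)%:C * u); last by rewrite su.
    split; last by rewrite -(Qf n) su.
    rewrite normCE ltcR normcM normc_real ger0_norm ?exprn_ge0 ?(ltW lam0)//.
    by rewrite ltr_pM2l ?exprn_gt0.
rewrite -(count_undup a) natr_sum fsbig_seq ?filter_uniq ?undup_uniq//.
rewrite (reindex_fsbig _ _ _ _ bij) /zero_count; apply: eq_fsbigr => z /set_mem[/sr zr _].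
by rewrite (zero_mult_count (lt_le_trans zr rr)).
Qed.

End ZeroCount.

(** * The zero count between root counts in discs *)

Section ZeroCountBounds.
Context (R : realType).
Local Notation C := R[i].
Local Notation N := (@normc R).
Context (P : {poly C}) (lam : R) (f : C -> C).
Context (lam1 : 1 < lam) (P'0 : P^`().[0] = lam%:C) (sP : (1 < size P)%N).
Context (fE : forall z, f (lam%:C * z) = P.[f z]) (f0 : f 0 = 0).
Context (f'0 : is_derive (0 : C) (1 : C) f (1 : C)) (ef : entire f).

Let rs n := roots_seq (iter_poly P n - 0%:P).

Lemma zero_countE_near0 : exists2 r1 : R, 0 < r1 & forall n r, r <= r1 ->
  zero_count f (lam ^+ n * r) =
  (count (fun y => `[< exists2 u, N u < r & f u = y >]) (rs n))%:R.
Proof.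
have [r1 [K [r10 K0 Kr fid flip]]] := local_estimates lam1 P'0 fE f0 f'0.
exists r1 => // n r rr; apply: (@zero_countE _ P lam f lam1 sP fE ef r1 K K0 _ flip) => //.
move=> z w zr wr; apply: (le_trans (fid _ _ _ (lexx _) zr wr)).
by rewrite ler_wpM2r ?normc_ge0.
Qed.

Lemma zero_count_bounds (kappa : R) : 1 < kappa -> exists2 r2 : R, 0 < r2 &
  forall r n, 0 < r < r2 ->
    zero_count f (lam ^+ n * r) <= (count (fun y => N y < kappa * r) (rs n))%:R /\
    (count (fun y => N y < r) (rs n))%:R <= zero_count f (lam ^+ n * (kappa * r)).
Proof.
move=> k1; have k0 : 0 < kappa := lt_trans ltr01 k1.
have [r1 [K [r10 K0 Kr fid _]]] := local_estimates lam1 P'0 fE f0 f'0.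
have [r0 r00 cE] := zero_countE_near0.
(* The first entry gives [N (f u) <= kappa * N u]; the second gives each [y] a preimage of modulus
   at most [kappa * N y]. *)
pose d := Num.min (kappa - 1) (1 - kappa^-1).
have dpos : 0 < d by rewrite lt_min !subr_gt0 k1 invf_lt1.
pose rho := Num.min (Num.min r1 r0) (d / (K + 1)).
have K10 : 0 < K + 1 by rewrite ltr_wpDl.
have rho0 : 0 < rho by rewrite !lt_min r10 r00 divr_gt0.
have rho1 : rho <= r1 by rewrite !ge_min lexx.
have rho2 : rho <= r0 by rewrite !ge_min lexx orbT.
have Krho : K * rho <= d.
  have : rho * (K + 1) <= d by rewrite -ler_pdivlMr// !ge_min lexx !orbT.
  by apply: le_trans; rewrite mulrDr mulr1 mulrC lerDl ltW.
have Krho2 : 0 <= K * rho <= 1 / 2.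
  rewrite mulr_ge0 ?(ltW rho0)//=; apply: le_trans Kr; exact: ler_wpM2l.
have kd : K * rho <= 1 - kappa^-1 by apply: (le_trans Krho); rewrite ge_min lexx orbT.
have kd' : K * rho <= kappa - 1 by apply: (le_trans Krho); rewrite ge_min lexx.
exists (rho / kappa); first by rewrite divr_gt0.
move=> r n /andP[rpos]; rewrite ltr_pdivlMr// => rk.
have rk' : kappa * r <= rho by rewrite mulrC ltW.
have rr : r <= rho by apply: le_trans rk'; rewrite ler_peMl ?ltW.
rewrite !cE ?(le_trans _ rho2)//; split; rewrite ler_nat; apply: sub_count.
  move=> y /asboolP[u ur <-].
  have N0 : N 0 <= rho by rewrite normc0 ltW.
  have := fid rho u 0 rho1 (le_trans (ltW ur) rr) N0; rewrite f0 !subr0 => h.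
  have {h} : N (f u) <= kappa * N u.
    rewrite -[f u](subrK u) (le_trans (ler_normcD _ _))//.
    have := normc_ge0 u; move: h kd'; set a := N (f u - u); set b := N u; set e := K * rho.
    move=> h1 h2 h3; have : e * b <= (kappa - 1) * b by rewrite ler_wpM2r.
    lra.
  by move=> h; rewrite (le_lt_trans h)// ltr_pM2l.
move=> y yr; apply/asboolP.
have c1 : 0 < 1 - K * rho by move/andP: Krho2 => [_ h]; lra.
(* Smallest radius whose image is guaranteed to contain [y]. It is at most [kappa * N y], so the
   strict inequality [N y < r] puts the preimage in the open disc. *)
pose R' := N y / (1 - K * rho).
have R'k : R' <= kappa * N y.
  rewrite /R' (mulrC kappa) ler_wpM2l ?normc_ge0// -[kappa]invrK.
  by rewrite lef_pV2 ?posrE ?invr_gt0//; lra.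
have R'r : R' < kappa * r by rewrite (le_lt_trans R'k)// ltr_pM2l.
have R'rho : R' <= rho := le_trans (ltW R'r) rk'.
have fidR z w : N z <= R' -> N w <= R' -> N (f z - f w - (z - w)) <= K * rho * N (z - w).
  by move=> zr wr; apply: fid => //; exact: le_trans R'rho.
have yR : N y <= (1 - K * rho) * R' by rewrite /R' mulrC divfK// gt_eqF.
have [u uR fu] := near_identity_surj Krho2 f0 fidR yR.
by exists u => //; exact: le_lt_trans R'r.
Qed.

End ZeroCountBounds.

(** * The fixed point 0 is not exceptional *)

Section Exceptional.
Context (R : realType).
Local Notation C := R[i].
Context (P : {poly C}).

Lemma iter_polySr n w : (iter_poly P n.+1).[w] = (iter_poly P n).[P.[w]].
Proof.
elim: n => [|n IH]; first by rewrite /= comp_polyXr hornerX.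
by rewrite [in LHS]/= horner_comp IH [in RHS]/= horner_comp.
Qed.

(* A nonzero preimage of [0] exists because [0] is a simple root; its successive
   preimages are pairwise distinct. *)
Lemma not_exceptional0 : P.[0] = 0 -> P^`().[0] != 0 -> (2 < size P)%N ->
  ~ exceptional P 0.
Proof.
move=> P0 P'0 sP /finite_seqP[s sE].
have [Q PE] : exists Q, P = Q * 'X.
  have /factor_theorem[Q] : root P 0 by rewrite rootE P0.
  by rewrite subr0 => ->; exists Q.
have Q0 : Q.[0] != 0.
  by move: P'0; rewrite PE derivM derivX !hornerE.
have Pn0 : P != 0 by rewrite -size_poly_gt0 (ltn_trans _ sP).
have sQ : size Q != 1%N.
  move: sP; rewrite PE size_mulX; last by apply: contraNneq Pn0 => Q00; rewrite PE Q00 mul0r.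
  by case: (size Q) => [|[|n]].
have /closed_rootP[z0 /rootP Qz0] := sQ.
have z00 : z0 != 0 by apply: contraNneq Q0 => z00; move: Qz0; rewrite z00 => ->.
have Pz0 : P.[z0] = 0 by rewrite PE hornerM Qz0 mul0r.
have pre e : exists z, P.[z] = e.
  have /closed_rootP[z /rootP] : size (P - e%:P) != 1%N.
    rewrite size_polyDl ?size_polyN; first by rewrite gtn_eqF// ltnW.
    by rewrite (leq_ltn_trans (size_polyC_leq1 _))// ltnW.
  by rewrite hornerD hornerN hornerC => /eqP; rewrite subr_eq0 => /eqP ?; exists z.
have /choice[g gE] := pre.
pose z n := iter n g z0.
have zn n : (iter_poly P n).[z n] = z0.
  by elim: n => [|n IH]; rewrite ?hornerX// iter_polySr /= gE.
have iter0 n : (iter_poly P n).[0] = 0.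
  by elim: n => [|n IH]; rewrite ?hornerX//= horner_comp IH.
have z_neq0 n : z n != 0.
  by apply: contraNneq z00 => zn0; rewrite -(zn n) zn0 iter0.
have zS n : P.[z n.+1] = z n by rewrite /= gE.
(* Applying [P] lowers both indices; at [i = 0], equality would force [z j' = P.[z0] = 0] for the
   predecessor [j'] of [j]. *)
have z_inj i j : (i < j)%N -> z i != z j.
  elim: i j => [|i IH] [|j] // ij; apply/eqP => zz.
    by have := z_neq0 j; rewrite -zS -zz Pz0 eqxx.
  by have := IH j ij; rewrite -[z i]zS zz zS eqxx.
have zE n : exists m, (iter_poly P m).[z n] = 0.
  by exists n.+1; rewrite /= horner_comp zn.
pose l := [seq z i | i <- iota 0 (size s).+1].
have lu : uniq l.
  rewrite map_inj_in_uniq ?iota_uniq// => i j _ _ zz.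
  by case: (ltngtP i j) => // /z_inj; rewrite zz eqxx.
have ls : {subset l <= s}.
  move=> y /mapP[i _ ->]; have : [set w | exists n, (iter_poly P n).[w] = 0] (z i) by exact: zE.
  by rewrite sE.
by have := uniq_leq_size lu ls; rewrite size_map size_iota ltnn.
Qed.

End Exceptional.

(** * Discs and weak limits *)

Section Cutoff.
Context (R : realType).
Local Notation C := R[i].
Local Notation N := (@normc R).

Definition cutoff (a b : R) (z : C) : R := Num.max 0 (Num.min 1 ((b - N z) / (b - a))).

Lemma normc_continuous : continuous N.
Proof.
move=> z; have FF : Filter (nbhs z) by exact: nbhs_filter.
apply: (iffRL (@cvgrPdist_lt R R C (nbhs z) FF N (N z))) => e e0.
exists e%:C => /=; first by rewrite ltcR.
move=> w /=; rewrite normCE ltcR normc_distC distrC => wz.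
apply: le_lt_trans wz; rewrite ler_norml.
have := ler_normcD (z - w) w; have := ler_normcD (w - z) z.
by rewrite !subrK (normc_distC w z); lra.
Qed.

Lemma cutoff_continuous a b : continuous (cutoff a b).
Proof.
move=> z; have c3 : {for z, continuous (fun z => (b - N z) / (b - a))}.
  have FF : Filter (nbhs z) by exact: nbhs_filter.
  have cN := @normc_continuous z.
  exact: (cvgM (cvgB (cvg_cst b) cN) (cvg_cst _)).
have FF : Filter (nbhs z) by exact: nbhs_filter.
exact: (@continuous_max R C (cst 0) _ z (cvg_cst _) (@continuous_min R C (cst 1) _ z (cvg_cst _) c3)).
Qed.

Lemma cutoff_ge0 a b z : 0 <= cutoff a b z.
Proof. by rewrite le_max lexx. Qed.

Lemma cutoff_le1 a b z : cutoff a b z <= 1.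
Proof. by rewrite ge_max ler01 ge_min lexx. Qed.

Lemma cutoff1 a b z : a < b -> N z < a -> cutoff a b z = 1.
Proof.
move=> ab za; rewrite /cutoff min_l ?max_r// ler_pdivlMr ?subr_gt0// mul1r; lra.
Qed.

Lemma cutoff0 a b z : a < b -> b <= N z -> cutoff a b z = 0.
Proof.
move=> ab zb; rewrite /cutoff max_l// ge_min; apply/orP; right.
by rewrite ler_pdivrMr ?subr_gt0// mul0r subr_le0.
Qed.

Definition cball (t : R) : set (borelC R) := [set w : C | `|w| < t%:C].

Lemma cballE t z : cball t z <-> N z < t.
Proof. by rewrite /cball /= normCE ltcR. Qed.

Lemma open_measurableC (A : set C) : open A -> measurable (A : set (borelC R)).
Proof. by move=> oA; apply: sub_sigma_algebra. Qed.

Lemma measurable_cball t : measurable (cball t).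
Proof.
have -> : cball t = N @^-1` [set x | x < t].
  by apply/seteqP; split => z /=; rewrite /cball /= normCE ltcR.
apply: open_measurableC.
by apply: open_comp; [move=> z _; exact: normc_continuous|exact: open_lt].
Qed.

Lemma continuous_measurableC (g : C -> R) : continuous g ->
  measurable_fun [set: borelC R] (g : borelC R -> R).
Proof.
move=> cg; apply: (measurability _ (RGenOInfty.measurableE R)).
move=> /= _ [_ [x ->] <-]; rewrite setTI; apply: open_measurableC.
by apply: open_comp; [move=> z _; exact: cg|exact: interval_open].
Qed.

Lemma cutoff_integral (nu : {measure set borelC R -> \bar R}) a b : a < b ->
  (nu (cball a) <= \int[nu]_z (cutoff a b z)%:E <= nu (cball b))%E.
Proof.
move=> ab.
have mc : measurable_fun [set: borelC R] (fun z : borelC R => (cutoff a b z)%:E).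
  by apply/measurable_EFinP; exact: (continuous_measurableC (@cutoff_continuous a b)).
have mi t : measurable_fun [set: borelC R] (fun z : borelC R => (\1_(cball t) z)%:E : \bar R).
  by apply/measurable_EFinP; apply: measurable_indic; exact: measurable_cball.
have iE t : nu (cball t) = (\int[nu]_z (\1_(cball t) z)%:E)%E.
  by rewrite integral_indic ?setIT//; exact: measurable_cball.
rewrite !iE; apply/andP; split; apply: ge0_le_integral => //.
- move=> z _; rewrite lee_fin indicE; have [zt|_] := boolP (z \in cball a); last exact: cutoff_ge0.
  by move/set_mem/cballE : zt => zt; rewrite cutoff1.
- by move=> z _; rewrite lee_fin cutoff_ge0.
- move=> z _; rewrite lee_fin indicE; have [_|zt] := boolP (z \in cball b); first exact: cutoff_le1.
  have [zb|zb] := leP b (N z); first by rewrite cutoff0.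
  by case/negP: zt; apply/mem_set/cballE.
Qed.

Lemma preimage_measure_cball (P : {poly C}) n t :
  preimage_measure P 0 n (cball t) =
  (((size P).-1%:R ^- n) * (count (fun y => N y < t) (roots_seq (iter_poly P n - 0%:P)))%:R)%:E.
Proof.
rewrite /preimage_measure /= /mscale /= /msum /= EFinM; congr (_ * _)%E.
set rs := roots_seq _.
pose ind (y : C) : R := (N y < t)%R%:R.
rewrite (eq_bigr (fun k : 'I_(size rs) => (ind (nth 0 rs k))%:E)); last first.
  move=> k _; rewrite diracE /ind; congr (_%:R%:E); congr nat_of_bool.
  apply/idP/idP => [/set_mem/cballE//|h]; exact/mem_set/cballE.
rewrite -(big_mkord xpredT (fun k => (ind (nth 0 rs k))%:E)) sumEFin; congr (_%:E).
rewrite -(big_nth 0 xpredT ind) -natr_sum; congr (_%:R).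
by rewrite -sum1_count [RHS]big_mkcond /=; apply: eq_bigr => y _; case: ifP.
Qed.

(** The gap [a < b] makes room for a continuous cutoff, whose integral [I] against [mu] lies between
    the masses of the two discs; [eta] absorbs the error of weak convergence at this single test
    function. *)
Lemma weak_cvg_count (P : {poly C}) (mu : probability (borelC R) R) (a b eta : R) :
  weak_cvg (preimage_measure P 0) mu -> a < b -> 0 < eta -> (1 < size P)%N ->
  let d := ((size P).-1%:R : R) in
  let c t n := ((count (fun y => N y < t) (roots_seq (iter_poly P n - 0%:P)))%:R : R) in
  \forall n \near \oo, c a n <= d ^+ n * (fine (mu (cball b)) + eta) /\
    d ^+ n * (fine (mu (cball a)) - eta) <= c b n.
Proof.
move=> wc ab eta0 sP d c.
have d0 n : 0 < d ^+ n by rewrite exprn_gt0// ltr0n ltn_predRL.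
have muf t : mu (cball t) \is a fin_num by apply: fin_num_measure; exact: measurable_cball.
have /andP[ma mb] := cutoff_integral mu ab.
have [I IE] : exists I, (\int[mu]_z (cutoff a b z)%:E)%E = I%:E.
  exists (fine (\int[mu]_z (cutoff a b z)%:E)%E).
  rewrite fineK// ge0_fin_numE; first by rewrite (le_lt_trans mb)// ltey_eq muf.
  by apply: integral_ge0 => z _; rewrite lee_fin cutoff_ge0.
have Ia : fine (mu (cball a)) <= I by rewrite -lee_fin fineK// -IE.
have Ib : I <= fine (mu (cball b)) by rewrite -lee_fin fineK// -IE.
pose nu := preimage_measure P 0.
have H : (\int[nu n]_z (cutoff a b z)%:E)%E @[n --> \oo] --> (\int[mu]_z (cutoff a b z)%:E)%E.
  apply: wc; first exact: cutoff_continuous.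
  by exists 1 => z; rewrite ger0_norm ?cutoff_ge0// cutoff_le1.
rewrite IE in H.
have : \forall n \near \oo, ((I - eta)%:E < \int[nu n]_z (cutoff a b z)%:E < (I + eta)%:E)%E.
  have e1 : ((I - eta)%:E < I%:E)%E by rewrite lte_fin gtrBl.
  have e2 : (I%:E < (I + eta)%:E)%E by rewrite lte_fin ltrDl.
  have B : nbhs I%:E ([set x | (I - eta)%:E < x]%E `&` [set x | x < (I + eta)%:E]%E).
    apply: filterI; apply: open_nbhs_nbhs; split => //.
      exact: open_ereal_gt_ereal.
    exact: open_ereal_lt_ereal.
  have [n0 _ hn] := H _ B; exists n0 => // n /hn [h1 h2].
  by apply/andP.
apply: filterS => n /andP[h1 h2].
have /andP[] := cutoff_integral (nu n) ab.
rewrite /nu !preimage_measure_cball -!/(c _ _) => h3 h4.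
have {}h3 := le_lt_trans h3 h2; have {}h4 := lt_le_trans h1 h4.
move: h3 h4; rewrite !lte_fin mulrC ltr_pdivrMr// => h3; rewrite mulrC ltr_pdivlMr// => h4.
split; first by apply: (le_trans (ltW h3)); rewrite mulrC ler_pM2l// lerD2r.
by apply: le_trans (ltW h4); rewrite mulrC ler_pM2r// lerD2r.
Qed.

End Cutoff.

(** * Limits along geometric scales *)

Section ScalingLimits.
Context (R : realType).
Implicit Types (x y t r e : R).

(** Here [a] and [b] stand for the normalised counts at two consecutive grid radii and [x] for the
    count at a radius between them. Two factors [M] accumulate, hence the term [(M * M - 1) * L]. *)
Lemma ratio_squeeze (L e M a b x : R) : 0 <= L -> 0 < e -> 1 < M -> M <= 2 ->
  (M - 1) * L <= e / 8 -> b <= M * (L + e / 16) + e / 16 ->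
  L - 2 * (e / 16) <= M * a -> a <= M * x -> x <= M * b -> `|L - x| < e.
Proof.
move=> L0 e0 M1 M2 ML hb ha ax xb; have M0 : 0 < M by lra.
have MML : (M * M - 1) * L <= 3 * (e / 8).
  rewrite (_ : (M * M - 1) * L = (M + 1) * ((M - 1) * L)); last by ring.
  by apply: ler_pM => //; [lra|rewrite mulr_ge0//; lra|lra].
have MM : 1 <= M * M <= 4 by apply/andP; split; nra.
have MMe : M * M * (e / 16) <= 4 * (e / 16) by rewrite ler_pM2r//; lra.
have Me : M * (e / 16) <= 2 * (e / 16) by rewrite ler_pM2r// divr_gt0.
rewrite ltr_norml; apply/andP; split.
  have : M * b <= M * (M * (L + e / 16) + e / 16) by rewrite ler_pM2l.
  rewrite (_ : M * (M * (L + e / 16) + e / 16) =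
    M * M * L + M * M * (e / 16) + M * (e / 16)); last by ring.
  lra.
rewrite ltNge; apply/negP => h5.
have h6 : M * M * x <= M * M * (L - e) by rewrite ler_pM2l ?mulr_gt0//; lra.
have : M * a <= M * (M * x) by rewrite ler_pM2l.
have : 1 * e <= M * M * e by rewrite ler_pM2r//; lra.
rewrite (mulrA M M x); lra.
Qed.

Lemma eventually_forall (P : nat -> nat -> Prop) m :
  (forall j, (j < m)%N -> \forall n \near \oo, P n j) ->
  \forall n \near \oo, forall j, (j < m)%N -> P n j.
Proof.
elim: m => [|m IH] H; first by exists 0%N.
have [n0 _ h0] := IH (fun j jm => H j (ltnW jm)); have [n1 _ h1] := H m (ltnSn m).
exists (maxn n0 n1) => // n /=; rewrite geq_max => /andP[n0n n1n] j.
by rewrite ltnS leq_eqVlt => /orP[/eqP ->|jm]; [exact: h1|exact: h0].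
Qed.

Lemma geometric_gt (a b : R) : 1 < a -> exists n0, forall n, (n0 <= n)%N -> b < a ^+ n.
Proof.
move=> a1; have [n0 h] : exists n, b < a ^+ n.
  have d0 : 0 < a - 1 by rewrite subr_gt0.
  have [n hn] : exists n : nat, b / (a - 1) < n%:R.
    by exists (Num.bound `|b / (a - 1)|); rewrite (le_lt_trans (ler_norm _))// archi_boundP.
  exists n; apply: lt_le_trans (_ : n%:R * (a - 1) <= _); first by rewrite -ltr_pdivrMr.
  elim: n {hn} => [|n IH]; first by rewrite mul0r expr0.
  have -> : a ^+ n.+1 = a ^+ n + a ^+ n * (a - 1) by rewrite exprSr; ring.
  rewrite -natr1 mulrDl mul1r lerD//.
  by rewrite ler_peMl ?(ltW d0)// exprn_ege1// ltW.
exists n0 => n n0n; apply: (lt_le_trans h).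
by rewrite -(subnKC n0n) exprD ler_peMr ?exprn_ege1 ?exprn_ge0 ?(ltW a1)// (le_trans _ (ltW a1)).
Qed.

Lemma geometric_floor (a b x : R) : 1 < a -> 0 < b -> b <= x ->
  exists2 i : nat, b * a ^+ i <= x & x < b * a ^+ i.+1.
Proof.
move=> a1 b0 bx; have [n0 h] := geometric_gt (x / b) a1.
have : exists n, x < b * a ^+ n by exists n0; rewrite mulrC -ltr_pdivrMr// h.
move=> /ex_minnP[[|i] xi imin]; first by move: xi; rewrite expr0 mulr1 ltNge bx.
by exists i => //; rewrite leNgt; apply/negP => /imin; rewrite ltnn.
Qed.

Lemma cvg_pinftyP (h : R -> R) : cvg (h x @[x --> +oo]) <->
  exists L, forall e, 0 < e -> exists X, forall x, X < x -> `|L - h x| < e.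
Proof.
split=> [/cvg_ex[L /cvgrPdist_lt hL]|[L hL]].
  by exists L => e /hL[X [_ hX]]; exists X.
apply/cvg_ex; exists L; apply/cvgrPdist_lt => e /hL[X hX].
by exists X; split => //; exact: num_real.
Qed.

Lemma cvg_at_right0P (k : R -> R) : cvg (k t @[t --> 0^'+]) <->
  exists L, forall e, 0 < e -> exists2 r, 0 < r & forall t, 0 < t < r -> `|L - k t| < e.
Proof.
split=> [/cvg_ex[L /cvgrPdist_lt kL]|[L kL]].
  exists L => e /kL[r /= r0 hr]; exists r => // t /andP[t0 tr].
  by apply: hr => //=; rewrite sub0r normrN gtr0_norm.
apply/cvg_ex; exists L; apply/cvgrPdist_lt => e /kL[r r0 hr].
exists r => // t /=; rewrite sub0r normrN => tr t0; apply: hr.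
by rewrite t0 (le_lt_trans (ler_norm _) tr).
Qed.

Context (lam d : R) (lam1 : 1 < lam) (d1 : 1 < d).
(** [w] stands for the power with exponent [- rho], [Nf] for the zero count, [F t] for the mass of
    the disc of radius [t], and [c n t] for the number of roots of the [n]-th iterate in that
    disc. *)
Context (w Nf F : R -> R) (c : nat -> R -> R).
Context (w_gt0 : forall x, 0 < x -> 0 < w x)
  (wM : forall x y, 0 < x -> 0 < y -> w (x * y) = w x * w y)
  (w_anti : forall x y, 0 < x -> x <= y -> w y <= w x)
  (w_lam : w lam = d^-1).
Context (Nf_ge0 : forall x, 0 < x -> 0 <= Nf x)
  (Nf_homo : forall x y, 0 < x -> x <= y -> Nf x <= Nf y)
  (F_ge0 : forall t, 0 < t -> 0 <= F t).
Context
  (count_Nf : forall kappa, 1 < kappa -> exists2 r2 : R, 0 < r2 & forall r n, 0 < r < r2 ->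
    Nf (lam ^+ n * r) <= c n (kappa * r) /\ c n r <= Nf (lam ^+ n * (kappa * r)))
  (count_F : forall a b eta, a < b -> 0 < eta -> \forall n \near \oo,
    c n a <= d ^+ n * (F b + eta) /\ d ^+ n * (F a - eta) <= c n b).

Let h x := w x * Nf x.
Let k t := w t * F t.

Let lam0 : 0 < lam. Proof. exact: lt_trans lam1. Qed.
Let d0 : 0 < d. Proof. exact: lt_trans d1. Qed.

Let w1 : w 1 = 1.
Proof.
have := w_gt0 ltr01; have := wM ltr01 ltr01; rewrite mulr1 => e p.
by apply: (mulfI (lt0r_neq0 p)); rewrite -e mulr1.
Qed.

Let wX x n : 0 < x -> w (x ^+ n) = w x ^+ n.
Proof.
by move=> x0; elim: n => [|n IH]; rewrite ?expr0 ?w1// !exprS wM ?exprn_gt0// IH.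
Qed.

Let w_lamX n r : 0 < r -> w (lam ^+ n * r) = w r / d ^+ n.
Proof. by move=> r0; rewrite wM ?exprn_gt0// wX// w_lam exprVn mulrC. Qed.

(** [kappa] is spent in two equal parts [kp]: one on the distortion of [f], the other on the gap
    needed by the cutoff. The scale [lam ^+ n] disappears because [w] turns it into [d ^- n]. *)
Let ratio_step (kappa M : R) : 1 < kappa -> w kappa = M^-1 -> exists2 r2, 0 < r2 &
  forall r eta, 0 < r < r2 -> 0 < eta -> \forall n \near \oo,
    h (lam ^+ n * r) <= M * k (kappa * r) + eta /\ k r - eta <= M * h (lam ^+ n * (kappa * r)).
Proof.
move=> k1 wk; have k0 : 0 < kappa := lt_trans ltr01 k1.
have M0 : 0 < M by rewrite -invr_gt0 -wk w_gt0.
pose kp := Num.sqrt kappa.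
have kpE : kp * kp = kappa by rewrite -expr2 sqr_sqrtr// ltW.
have kp1 : 1 < kp by rewrite -[X in X < _]sqrtr1 ltr_sqrt.
have kp0 : 0 < kp := lt_trans ltr01 kp1.
have [r2 r20 H] := count_Nf kp1.
exists (r2 / kp); first by rewrite divr_gt0.
move=> r eta /andP[r0 rr] eta0.
have rr2 : 0 < r < r2.
  by rewrite r0/= (lt_trans rr)// ltr_pdivrMr// ltr_pMr.
have krr2 : 0 < kp * r < r2 by rewrite mulr_gt0//= mulrC -ltr_pdivlMr.
have wr := w_gt0 r0.
have eta' : 0 < eta / w r by rewrite divr_gt0.
have l1 : kp * r < kappa * r by rewrite ltr_pM2r// -kpE ltr_pMr.
have l2 : r < kp * r by rewrite ltr_pMl.
have [n1 _ H1] := count_F l1 eta'; have [n2 _ H2] := count_F l2 eta'.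
exists (maxn n1 n2) => // n /=; rewrite geq_max => /andP[/H1[h1 _] /H2[_ h2]].
have [h3 _] := H r n rr2; have [_ h4] := H (kp * r) n krr2.
rewrite (mulrA kp) kpE in h4.
have {}h3 := le_trans h3 h1; have {}h4 := le_trans h2 h4.
have dn0 : 0 < d ^+ n by rewrite exprn_gt0.
have kE : M * k (kappa * r) = w r * F (kappa * r).
  by rewrite /k wM// wk !mulrA divff ?gt_eqF// mul1r.
have hE : M * h (lam ^+ n * (kappa * r)) = w r / d ^+ n * Nf (lam ^+ n * (kappa * r)).
  by rewrite /h w_lamX ?mulr_gt0// wM// wk !mulrA divff ?gt_eqF// mul1r.
split.
  rewrite kE /h w_lamX// mulrAC ler_pdivrMr//.
  apply: (le_trans (ler_wpM2l (ltW wr) h3)).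
  rewrite le_eqVlt; apply/orP; left; apply/eqP.
  by rewrite mulrCA mulrDr (mulrC (w r) (eta / _)) divfK ?gt_eqF// mulrC.
rewrite hE mulrAC ler_pdivlMr//.
apply: le_trans (ler_wpM2l (ltW wr) h4).
rewrite le_eqVlt; apply/orP; left; apply/eqP.
by rewrite mulrCA mulrBr (mulrC (w r) (eta / _)) divfK ?gt_eqF// mulrC.
Qed.

Let h_ge0 x : 0 < x -> 0 <= h x.
Proof. by move=> x0; rewrite mulr_ge0 ?Nf_ge0// ltW// w_gt0. Qed.

Let k_ge0 t : 0 < t -> 0 <= k t.
Proof. by move=> t0; rewrite mulr_ge0 ?F_ge0// ltW// w_gt0. Qed.

Let h_step kappa M x y : 0 < kappa -> w kappa = M^-1 -> 0 < x -> x <= y -> y <= kappa * x ->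
  h x <= M * h y.
Proof.
move=> k0 wk x0 xy yx; have M0 : 0 < M by rewrite -invr_gt0 -wk w_gt0.
have y0 : 0 < y := lt_le_trans x0 xy.
have wxy : w x <= M * w y.
  have -> : w x = M * w (kappa * x) by rewrite wM// wk mulrA divff ?gt_eqF// mul1r.
  by rewrite ler_pM2l// w_anti.
by rewrite mulrA ler_pM ?Nf_ge0 ?Nf_homo// ltW// w_gt0.
Qed.

Context (small_ratio : forall delta, 0 < delta -> exists m kappa M,
  [/\ (0 < m)%N, 1 < kappa, kappa ^+ m = lam, w kappa = M^-1 & 1 < M <= 1 + delta]).

Lemma scaling_limit_to0 : cvg (h x @[x --> +oo]) -> cvg (k t @[t --> 0^'+]).
Proof.
move=> /cvg_pinftyP[L hL]; apply/cvg_at_right0P; exists L => e e0.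
have L0 : 0 <= L.
  apply/ler_addgt0Pr => a /hL[X /(_ (Num.max X 0 + 1))].
  have x0 : 0 < Num.max X 0 + 1 by rewrite ltr_wpDl// le_max lexx orbT.
  have xX : X < Num.max X 0 + 1 by rewrite (@le_lt_trans _ _ (Num.max X 0)) ?le_max ?lexx// ltrDl.
  by move=> /(_ xX); rewrite ltr_norml => /andP[+ _]; have := h_ge0 x0; lra.
pose delta := Num.min 1 (e / (2 * (L + 1))).
have L10 : 0 < 2 * (L + 1) by rewrite mulr_gt0// ltr_wpDl.
have delta0 : 0 < delta by rewrite lt_min ltr01 divr_gt0.
have delta1 : delta <= 1 by rewrite ge_min lexx.
have deltaL : delta * L <= e / 2.
  have : delta * (2 * (L + 1)) <= e by rewrite -ler_pdivlMr// ge_min lexx orbT.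
  lra.
have [m [kappa [M [_ k1 _ wk /andP[M1 Md]]]]] := small_ratio delta0.
have k0 : 0 < kappa := lt_trans ltr01 k1.
have [r2 r20 H] := ratio_step k1 wk.
have e80 : 0 < e / 8 by rewrite divr_gt0.
have [X hX] := hL _ e80.
(* [r2] depends on [e] alone, through [kappa]; [n] is chosen afterwards for each [t], so no
   uniformity in [t] is required. *)
exists r2 => // t /andP[t0 tr].
have far r : 0 < r -> \forall n \near \oo, `|L - h (lam ^+ n * r)| < e / 8.
  move=> r0; have [n0 hn] := geometric_gt (X / r) lam1.
  by exists n0 => // n /= /hn; rewrite ltr_pdivrMr// => /hX.
have tk : 0 < t / kappa < r2.
  by rewrite divr_gt0//= (lt_trans _ tr)// ltr_pdivrMr// ltr_pMr.
have t2 : 0 < t < r2 by rewrite t0.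
have [/= n [h1 [h2 [h3 h4]]]] : exists n,
    h (lam ^+ n * (t / kappa)) <= M * k (kappa * (t / kappa)) + e / 8 /\
    (k t - e / 8 <= M * h (lam ^+ n * (kappa * t)) /\
    (`|L - h (lam ^+ n * (t / kappa))| < e / 8 /\
     `|L - h (lam ^+ n * (kappa * t))| < e / 8)).
  have kt0 : 0 < kappa * t by rewrite mulr_gt0.
  have tk0 : 0 < t / kappa by rewrite divr_gt0.
  have [n1 _ a1] := H _ _ tk e80; have [n2 _ a2] := H _ _ t2 e80.
  have [n3 _ a3] := far _ tk0; have [n4 _ a4] := far _ kt0.
  exists (maxn (maxn n1 n2) (maxn n3 n4)); split; [|split; [|split]].
  - by apply: (a1 _ _).1; rewrite /= !leq_max leqnn.
  - by apply: (a2 _ _).2; rewrite /= !leq_max leqnn !orbT.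
  - by apply: a3; rewrite /= !leq_max leqnn !orbT.
  - by apply: a4; rewrite /= !leq_max leqnn !orbT.
rewrite (mulrC kappa (t / kappa)) divfK ?gt_eqF// in h1.
move: h3 h4; rewrite !ltr_norml => /andP[h3 h3'] /andP[h4 h4'].
apply/andP; split.
  have : M * h (lam ^+ n * (kappa * t)) <= M * (L + e / 8) by rewrite ler_pM2l; lra.
  have : (M - 1) * L <= delta * L by rewrite ler_wpM2r//; lra.
  nra.
rewrite ltNge; apply/negP => h5.
have : M * k t <= M * (L - e) by rewrite ler_pM2l; lra.
have : (M - 1) * L <= delta * L by rewrite ler_wpM2r//; lra.
nra.
Qed.

Lemma scaling_limit_at_infinity : cvg (k t @[t --> 0^'+]) -> cvg (h x @[x --> +oo]).
Proof.
move=> /cvg_at_right0P[L kL]; apply/cvg_pinftyP; exists L => e e0.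
have L0 : 0 <= L.
  apply/ler_addgt0Pr => a /kL[r r0 /(_ (r / 2))].
  have r2 : 0 < r / 2 < r by rewrite divr_gt0//= ltr_pdivrMr// ltr_pMr// ltr1n.
  by move=> /(_ r2); rewrite ltr_norml => /andP[+ _]; have := k_ge0 (andP r2).1; lra.
pose delta := Num.min 1 (e / (8 * (L + 1))).
have L10 : 0 < 8 * (L + 1) by rewrite mulr_gt0// ltr_wpDl.
have delta0 : 0 < delta by rewrite lt_min ltr01 divr_gt0.
have delta1 : delta <= 1 by rewrite ge_min lexx.
have deltaL : delta * L <= e / 8.
  have : delta * (8 * (L + 1)) <= e by rewrite -ler_pdivlMr// ge_min lexx orbT.
  lra.
have [m [kappa [M [m0 k1 km wk /andP[M1 Md]]]]] := small_ratio delta0.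
have k0 : 0 < kappa := lt_trans ltr01 k1.
have [r2 r20 H] := ratio_step k1 wk.
have e10 : 0 < e / 16 by rewrite divr_gt0.
have [r3 r30 hr3] := kL _ e10.
(* The grid [x_ j] runs from [b] to [b * lam]; the extra [kappa] leaves room for the neighbour
   [kappa * x_ j], and the 2 makes the inequality strict. *)
pose b := Num.min r2 r3 / (2 * lam * kappa).
have mr : 0 < Num.min r2 r3 by rewrite lt_min r20.
have b0 : 0 < b by rewrite divr_gt0// !mulr_gt0.
have bE : b * lam * kappa < Num.min r2 r3.
  have -> : b * lam * kappa = Num.min r2 r3 / 2.
    by rewrite /b; field; rewrite !gt_eqF.
  by rewrite ltr_pdivrMr// ltr_pMr// ltr1n.
have b2 x : 0 < x -> x <= b * lam * kappa -> 0 < x < r2 /\ `|L - k x| < e / 16.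
  move=> x0 /le_lt_trans/(_ bE); rewrite lt_min => /andP[xr2 xr3].
  by rewrite x0 xr2 hr3// x0.
pose x_ j := b * kappa ^+ j.
have x_0 j : 0 < x_ j by rewrite mulr_gt0// exprn_gt0.
have M0 : 0 < M by lra.
(* The index [j = m] is included because a radius with remainder [m - 1] has its upper grid
   neighbour there. *)
have main j : (j < m.+1)%N -> \forall n \near \oo,
    h (lam ^+ n * x_ j) <= M * (L + e / 16) + e / 16 /\
    L - 2 * (e / 16) <= M * h (lam ^+ n * x_ j).
  rewrite ltnS => jm; have xj : x_ j <= b * lam.
    by rewrite /x_ ler_pM2l// -km ler_weXn2l// ltW.
  have xj1 : kappa * x_ j <= b * lam * kappa by rewrite mulrC ler_pM2r.
  have xj2 : x_ j <= b * lam * kappa.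
    by apply: (le_trans xj); rewrite ler_peMr ?(ltW k1)// ltW// mulr_gt0.
  have xj3 : x_ j / kappa <= b * lam * kappa.
    by apply: (le_trans _ xj2); rewrite ler_pdivrMr// ler_peMr ?(ltW k1)// ltW.
  have [A1 _] := b2 _ (x_0 j) xj2.
  have [_ A2] := b2 _ (mulr_gt0 k0 (x_0 j)) xj1.
  have [A3 A4] := b2 _ (divr_gt0 (x_0 j) k0) xj3.
  have [n1 _ H1] := H _ _ A1 e10; have [n2 _ H2] := H _ _ A3 e10.
  exists (maxn n1 n2) => // n /=; rewrite geq_max => /andP[/H1[h1 _] /H2[_]].
  rewrite (mulrC kappa (_ / _)) divfK ?gt_eqF// => h2.
  move: A2 A4; rewrite !ltr_norml => /andP[A2 _] /andP[_ A4].
  split; last by lra.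
  apply: (le_trans h1); rewrite lerD2r ler_pM2l//; lra.
have [n0 _ hn0] := eventually_forall main.
(* Beyond this radius the grid index [i] is at least [n0 * m], so its quotient by [m], the power of
   [lam], is at least [n0]. *)
exists (b * kappa ^+ (n0 * m)) => x xX.
have bx : b <= x.
  by apply: le_trans (ltW xX); rewrite ler_peMr ?exprn_ege1 ?(ltW k1)// ltW.
have [i ix xi] := geometric_floor k1 b0 bx.
have n0i : (n0 <= i %/ m)%N.
  rewrite leq_divRL// -ltnS -(ltr_eXn2l k1) -(ltr_pM2l b0).
  exact: lt_trans xX xi.
pose n := (i %/ m)%N; pose j := (i %% m)%N.
have iE : b * kappa ^+ i = lam ^+ n * x_ j.
  by rewrite (divn_eq i m) exprD mulnC exprM km -/n -/j /x_ mulrCA.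
have iE' : b * kappa ^+ i.+1 = lam ^+ n * x_ j.+1.
  by rewrite (exprS kappa i) mulrCA iE /x_ exprS; ring.
rewrite iE in ix; rewrite iE' in xi.
have jm : (j < m)%N by rewrite ltn_mod.
have [_ h2] := hn0 n n0i j (ltnW jm : (j < m.+1)%N).
have [h1 _] := hn0 n n0i j.+1 (jm : (j.+1 < m.+1)%N).
have y0 : 0 < lam ^+ n * x_ j by rewrite mulr_gt0// exprn_gt0.
have x0 : 0 < x := lt_le_trans b0 bx.
have yE : lam ^+ n * x_ j.+1 = kappa * (lam ^+ n * x_ j) by rewrite /x_ exprS; ring.
have h3 : h x <= M * h (lam ^+ n * x_ j.+1).
  by apply: (h_step k0 wk x0 (ltW xi)); rewrite yE ler_pM2l.
have h4 : h (lam ^+ n * x_ j) <= M * h x.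
  by apply: (h_step k0 wk y0 ix); rewrite -yE ltW.
have ML : (M - 1) * L <= e / 8.
  by apply: le_trans deltaL; rewrite ler_wpM2r// lerBlDl.
have M2 : M <= 2 by rewrite (le_trans Md)// lerD2l.
exact: (ratio_squeeze L0 e0 M1 M2 ML h1 h2 h4 h3).
Qed.

End ScalingLimits.

(** [kappa] and [M] are the [m]-th roots of [lam] and [d], with [m] so large that [(1 + delta) ^+ m]
    exceeds [d]; the identity [rho * ln lam = ln d] links them. *)
Lemma scaling_ratios (R : realType) (lam d : R) : 1 < lam -> 1 < d ->
  let rho := ln d / ln lam in forall delta : R, 0 < delta -> exists m kappa M,
  [/\ (0 < m)%N, 1 < kappa, kappa ^+ m = lam, kappa `^ (- rho) = M^-1 & 1 < M <= 1 + delta].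
Proof.
move=> lam1 d1 rho delta delta0.
have a1 : 1 < 1 + delta by rewrite ltrDl.
have [n0 h] := geometric_gt d a1.
pose m := n0.+1; have dm : d < (1 + delta) ^+ m by exact: h.
have m0 : m%:R != 0 :> R by rewrite pnatr_eq0.
have lnl : 0 < ln lam by rewrite ln_gt0.
have lnd : 0 < ln d by rewrite ln_gt0.
have eX (x : R) : 1 < x -> expR (ln x / m%:R) ^+ m = x.
  move=> x1; rewrite -expRM_natl mulrC divfK// lnK// posrE (lt_trans _ x1)//.
exists m, (expR (ln lam / m%:R)), (expR (ln d / m%:R)); split=> //.
- by rewrite expR_gt1 divr_gt0.
- exact: eX.
- rewrite /powR gt_eqF ?expR_gt0// expRK -expRN; congr expR.
  by rewrite /rho; field; rewrite m0 gt_eqF.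
- rewrite expR_gt1 divr_gt0//= leNgt; apply/negP => lt.
  have := eX _ d1; apply/eqP; rewrite gt_eqF//; apply: (lt_trans dm).
  by rewrite ltrXn2r// ltW// (lt_trans ltr01).
Qed.

(** * The equivalence *)

Theorem theorem5p2 (R : realType) (d : nat) (p : {poly R}) (lambda rho : R)
    (f : R[i] -> R[i]) (mu : probability (borelC R) R) :
  (2 <= d)%N -> p \is monic -> size p = d.+1 -> p.[0] = 0 ->
  lambda = p^`().[0] -> 1 < lambda -> rho = ln d%:R / ln lambda ->
  entire f -> (forall z, f (lambda%:C * z) = (map_poly (real_complex R) p).[f z]) ->
  f 0 = 0 -> 'D_1 f 0 = 1 ->
  harmonic_measure (map_poly (real_complex R) p) mu ->
  (~ cvg (x `^ (- rho) * zero_count f x @[x --> +oo])) <->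
  (~ cvg (t `^ (- rho) * fine (mu [set w | `|w| < t%:C]) @[t --> 0^'+])).
Proof.
move=> d2 _ sp p0 lamE lam1 rhoE ef fE f0 f'0 [_ hm].
set P := map_poly _ p in fE hm.
have sP : size P = d.+1 by rewrite size_map_poly.
have sP1 : (1 < size P)%N by rewrite sP ltnS ltnW.
have P0 : P.[0] = 0 by rewrite /P -(rmorph0 (real_complex R)) horner_map p0.
have P'0 : P^`().[0] = lambda%:C.
  by rewrite deriv_map -(rmorph0 (real_complex R)) horner_map lamE.
have lam0 : 0 < lambda := lt_trans ltr01 lam1.
have df0 : is_derive (0 : R[i]) (1 : R[i]) f (1 : R[i]).
  by have := derivableC_is_derive (ef 0); rewrite f'0.
have wc : weak_cvg (preimage_measure P 0) mu.
  apply: hm; apply: not_exceptional0 => //; last by rewrite sP.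
  by rewrite P'0 -normc_gt0 normc_real normr_gt0 gt_eqF.
have d1 : 1 < d%:R :> R by rewrite ltr1n.
have d0 : 0 < d%:R :> R := lt_trans ltr01 d1.
have lnl : 0 < ln lambda by rewrite ln_gt0.
have rho0 : 0 < rho by rewrite rhoE divr_gt0// ln_gt0.
have [r1 r10 cE] := zero_countE_near0 lam1 P'0 sP1 fE f0 df0 ef.
pose w (x : R) := x `^ (- rho).
pose c n t : R := (count (fun y => normc y < t)
  (roots_seq (iter_poly P n - 0%:P)))%:R.
pose F t := fine (mu (cball t)).
(* Every radius is a power of [lambda] times a small one, so the root-count formula reaches all
   radii. Monotonicity then follows by writing two radii with the same [n]. *)
have near_r1 (y : R) : exists n r, r <= r1 /\ y = lambda ^+ n * r.
  have [n0 /(_ n0 (leqnn _)) hn] := geometric_gt (y / r1) lam1.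
  have l0 : 0 < lambda ^+ n0 by rewrite exprn_gt0.
  exists n0, (y / lambda ^+ n0); split; last by rewrite mulrC divfK// gt_eqF.
  by rewrite ler_pdivrMr// -ler_pdivrMl// mulrC ltW.
have w_gt0 x : 0 < x -> 0 < w x by move=> x0; rewrite powR_gt0.
have wM x y : 0 < x -> 0 < y -> w (x * y) = w x * w y.
  by move=> x0 y0; rewrite /w powRM// ltW.
have w_anti x y : 0 < x -> x <= y -> w y <= w x.
  move=> x0 xy; have y0 := lt_le_trans x0 xy.
  by rewrite /w !powRN lef_pV2 ?posrE ?powR_gt0// ge0_ler_powR ?nnegrE// ltW.
have w_lam : w lambda = d%:R^-1.
  rewrite /w powRN; congr _^-1.
  by rewrite /powR gt_eqF// rhoE divfK ?gt_eqF// lnK.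
have Nf_ge0 x : 0 < x -> 0 <= zero_count f x.
  by move=> _; have [n [r [rr ->]]] := near_r1 x; rewrite cE.
have Nf_homo x y : 0 < x -> x <= y -> zero_count f x <= zero_count f y.
  move=> x0 xy; have [n [r [rr yE]]] := near_r1 y.
  have l0 : 0 < lambda ^+ n by rewrite exprn_gt0.
  have xE : x = lambda ^+ n * (x / lambda ^+ n) by rewrite mulrC divfK// gt_eqF.
  have xr : x / lambda ^+ n <= r by rewrite ler_pdivrMr// mulrC -yE.
  rewrite yE xE !cE//; last exact: le_trans rr.
  rewrite ler_nat; apply: sub_count => z /asboolP[u ux fu]; apply/asboolP.
  by exists u => //; exact: lt_le_trans xr.
have F_ge0 t : 0 < t -> 0 <= F t by move=> _; rewrite fine_ge0.
have count_F a b eta : a < b -> 0 < eta -> \forall n \near \oo,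
    c n a <= d%:R ^+ n * (F b + eta) /\ d%:R ^+ n * (F a - eta) <= c n b.
  by move=> ab eta0; have := weak_cvg_count wc ab eta0 sP1; rewrite sP.
have sr delta : 0 < delta -> exists m kappa M,
    [/\ (0 < m)%N, 1 < kappa, kappa ^+ m = lambda, w kappa = M^-1 & 1 < M <= 1 + delta].
  by move=> delta0; rewrite /w rhoE; exact: scaling_ratios.
have count_Nf := zero_count_bounds lam1 P'0 sP1 fE f0 df0 ef.
have to0 := scaling_limit_to0 lam1 d1 w_gt0 wM w_lam Nf_ge0 (F := F) (c := c) count_Nf count_F sr.
have toinf := scaling_limit_at_infinity lam1 d1 w_gt0 wM w_anti w_lam Nf_ge0 Nf_homo F_ge0
  (c := c) count_Nf count_F sr.
by split=> H; apply: contra_not H.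
Qed.
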